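(* Let $k\ge 3$ and $m\ge1$ be integers, let $\varepsilon>0$, and let $F$ be a $k$-partite $k$-graph each of whose $k$ parts has exactly $m$ vertices. Then there exists $n_0$ such that the following holds for every $n\ge n_0$ with $m\mid n$: if $H$ is a $k$-partite $k$-graph each of whose parts has exactly $n$ vertices and $\delta'_{k-1}(H)\ge(\frac12+\varepsilon)n$, then $H$ contains an $F$-factor.
   Context: A $k$-graph $H$ has a vertex set $V(H)$ and an edge set $E(H)$ consisting of $k$-element subsets of $V(H)$. A $k$-partite $k$-graph comes with a fixed partition $V(H)=V_1\cup\dots\cup V_k$ (its parts) such that every edge meets each $V_i$ in at most one vertex. A set $S\subseteq V(H)$ is legal if $|S\cap V_i|\le 1$ for all $i$. For $S\subseteq V(H)$ with $|S|=s<k$, $\deg_H(S)$ is the number of $(k-s)$-sets $S'$ with $S\cup S'\in E(H)$. The partite minimum $(k-1)$-degree (partite minimum codegree) $\delta'_{k-1}(H)$ is the minimum of $\deg_H(S)$ over all legal $(k-1)$-subsets $S$. An $F$-factor in $H$ is a set of pairwise vertex-disjoint subgraphs of $H$, each isomorphic to $F$, covering $V(H)$. *)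

(* Defs.v *)
From HB Require Import structures.
From mathcomp Require Import all_boot all_order all_algebra.
From mathcomp Require Import reals.
Set Implicit Arguments. Unset Strict Implicit. Unset Printing Implicit Defensive.

(* A k-partite k-graph whose k parts each have exactly n vertices is modelled on
   the vertex type 'I_k * 'I_n; the part of a vertex v is v.1, i.e. part i is
   V_i = [set v | v.1 == i].  A hypergraph is given by its edge set. *)

Definition kvert (k n : nat) : finType := ('I_k * 'I_n)%type.

Definition legal (k n : nat) (S : {set kvert k n}) : Prop :=
  forall i : 'I_k, #|[set v in S | v.1 == i]| <= 1.

Definition kpartite_kgraph (k n : nat) (E : {set {set kvert k n}}) : Prop :=
  forall e, e \in E -> #|e| = k /\ legal e.

Definition deg (k n : nat) (E : {set {set kvert k n}}) (S : {set kvert k n}) : nat :=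
  #|[set S' : {set kvert k n} | (#|S'| == k - #|S|) && (S :|: S' \in E)]|.

Definition is_copy (k m n : nat) (F : {set {set kvert k m}}) (H : {set {set kvert k n}})
  (phi : kvert k m -> kvert k n) : Prop :=
  injective phi /\ forall e, e \in F -> phi @: e \in H.

Definition has_F_factor (k m n : nat) (F : {set {set kvert k m}}) (H : {set {set kvert k n}}) : Prop :=
  exists (t : nat) (phis : 'I_t -> kvert k m -> kvert k n),
    [/\ forall j, is_copy F H (phis j),
        forall v : kvert k n, exists j x, phis j x = v &
        forall i j x y, phis i x = phis j y -> i = j].

(* Main.v *)
Require Import Defs.
From HB Require Import structures.
From mathcomp Require Import all_boot all_order all_algebra.
From mathcomp Require Import reals.
From mathcomp Require Import zify ring lra.
Import Order.TTheory GRing.Theory Num.Theory.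
Local Open Scope ring_scope.
Set Implicit Arguments. Unset Strict Implicit. Unset Printing Implicit Defensive.

(* It suffices to tile H with copies of K = K(m, ..., m), the complete k-partite
   k-graph. The proof is by absorption.

   Absorption. The links of two vertices x, x' of the same part have codegrees
   above n/2, so they overlap in a positive proportion, and by convexity there
   are c n^(km-1) sets W for which both W + x and W + x' span K. Given a km-set q
   with m vertices in each part, take a copy P of K and, for each a, a set W_a
   exchanging q_a for P_a: the union of P and the W_a has a K-factor (the sets
   W_a + P_a), and so has its union with q (P and the sets W_a + q_a). Hence a
   positive proportion of all candidates absorb any given q. Choosing disjoint
   absorbers greedily by multiplicative weights (halving the weight of q whenever
   it is absorbed) replaces the usual random selection: the total weight decays
   exponentially while there are only polynomially many q, so every q ends up
   with linearly many absorbers.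

   Almost perfect tiling (after Komlos). Suppose a tiling by copies of
   K(M, ..., M) leaves a set L of linear size. If L is dense, it contains a
   further tile. Otherwise almost all edges having all but one vertex in L end in
   tiles; since k/2 > 1, some tile B has two parts that see a positive proportion
   of the (k-1)-tuples of L. Each of these parts contains a subset of size
   M' = M / (24 k) completed in L to a copy of K(M', ..., M'), and the rest of B
   can be cut into tiles of size M': the covered set has grown. A bounded number
   of rounds covers all but eta n vertices of each part. *)

(** * Averages and resampling *)

Section Average.
Variable R : realType.

Definition avg (X : finType) (F : X -> R) : R := (\sum_x F x) / #|X|%:R.

Implicit Types X Y : finType.

Lemma eq_avg X (F G : X -> R) : F =1 G -> avg F = avg G.
Proof. by move=> eqFG; rewrite /avg; under eq_bigr do rewrite eqFG. Qed.

Lemma le_avg X (F G : X -> R) : (forall x, F x <= G x) -> avg F <= avg G.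
Proof.
by move=> leFG; apply: ler_wpM2r; rewrite ?invr_ge0 ?ler0n ?ler_sum.
Qed.

Lemma avg_ge0 X (F : X -> R) : (forall x, 0 <= F x) -> 0 <= avg F.
Proof. by move=> F0; rewrite divr_ge0 ?sumr_ge0 ?ler0n. Qed.

Lemma avg_const X (c : R) : (0 < #|X|)%N -> avg (fun _ : X => c) = c.
Proof.
move=> X0; rewrite /avg sumr_const -[c *+ _]mulr_natr mulfK // pnatr_eq0.
by rewrite -lt0n.
Qed.

Lemma avgD X (F G : X -> R) : avg (fun x => F x + G x) = avg F + avg G.
Proof. by rewrite /avg big_split /= mulrDl. Qed.

Lemma avgB X (F G : X -> R) : avg (fun x => F x - G x) = avg F - avg G.
Proof. by rewrite /avg sumrB mulrBl. Qed.

Lemma avgZl X (c : R) (F : X -> R) : avg (fun x => c * F x) = c * avg F.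
Proof. by rewrite /avg -mulr_sumr mulrA. Qed.

Lemma avgZr X (c : R) (F : X -> R) : avg (fun x => F x * c) = avg F * c.
Proof. by rewrite mulrC -avgZl; apply: eq_avg => x; rewrite mulrC. Qed.

Lemma avg_sum X (J : finType) (P : pred J) (F : J -> X -> R) :
  avg (fun x => \sum_(j | P j) F j x) = \sum_(j | P j) avg (F j).
Proof. by rewrite /avg exchange_big mulr_suml. Qed.

Lemma avgC X Y (F : X -> Y -> R) :
  avg (fun x => avg (F x)) = avg (fun y => avg (F^~ y)).
Proof.
rewrite /avg -!mulr_suml exchange_big /= -!mulrA; congr (_ * _).
by rewrite mulrC.
Qed.

Lemma avg_ex X (F : X -> R) (c : R) :
  (0 < #|X|)%N -> c <= avg F -> exists x, c <= F x.
Proof.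
move=> X0 cF; apply/existsP; apply: contraLR cF => /existsPn Fc.
rewrite -ltNge -(avg_const c X0) /avg ltr_pM2r ?invr_gt0 ?ltr0n //.
have /card_gt0P[x0 _] := X0.
apply: ltr_sum => [|x _]; last by rewrite ltNge Fc.
by apply/hasP; exists x0; rewrite ?mem_index_enum.
Qed.

Lemma avg_pred X (P : pred X) : avg (fun x => (P x)%:R) = #|P|%:R / #|X|%:R.
Proof.
by rewrite /avg -natr_sum; congr (_%:R / _); rewrite -big_mkcond sum1_card.
Qed.

Lemma avg_bij X Y (h : X -> Y) (F : Y -> R) :
  bijective h -> avg (fun x => F (h x)) = avg F.
Proof.
move=> bh; rewrite /avg (bij_eq_card bh); congr (_ / _).
by rewrite [RHS](reindex h) //; apply: onW_bij.
Qed.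

Lemma avg_pair X Y (F : X * Y -> R) :
  avg F = avg (fun x => avg (fun y => F (x, y))).
Proof.
rewrite /avg card_prod natrM invfM -mulr_suml mulrAC mulrA; congr (_ * _ * _).
by rewrite pair_big; apply: eq_bigr => -[].
Qed.

(** By convexity the tangent at [a] lies below the graph of the power; in the induction the error is
    a nonnegative multiple of [(x - a) ^+ 2]. *)
Lemma pow_tangent (m : nat) (a x : R) : 0 <= a -> 0 <= x ->
  a ^+ m.+1 + m.+1%:R * a ^+ m * (x - a) <= x ^+ m.+1.
Proof.
move=> a0 x0; elim: m => [|m IHm]; first by rewrite !expr1 expr0; lra.
rewrite [x ^+ _]exprS; apply: le_trans (ler_wpM2l x0 IHm).
rewrite -subr_ge0.
suff -> : x * (a ^+ m.+1 + m.+1%:R * a ^+ m * (x - a)) -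
  (a ^+ m.+2 + m.+2%:R * a ^+ m.+1 * (x - a)) =
  m.+1%:R * a ^+ m * (x - a) ^+ 2.
  by rewrite mulr_ge0 ?sqr_ge0 // mulr_ge0 ?exprn_ge0 // ler0n.
rewrite -[m.+2%:R]natr1 !exprS; ring.
Qed.

(** Jensen's inequality: in the average of the tangents at [avg F] the linear term vanishes. *)
Lemma avg_pow X (m : nat) (F : X -> R) : (0 < #|X|)%N -> (forall x, 0 <= F x) ->
  avg F ^+ m <= avg (fun x => F x ^+ m).
Proof.
move=> X0 F0; case: m => [|m]; first by rewrite expr0 avg_const.
have -> : avg F ^+ m.+1 =
    avg (fun x => avg F ^+ m.+1 + m.+1%:R * avg F ^+ m * (F x - avg F)).
  by rewrite avgD avgZl avgB !avg_const // subrr mulr0 addr0.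
by apply: le_avg => x; apply: pow_tangent => //; apply: avg_ge0.
Qed.

Section Resampling.
Variable T : finType.
Hypothesis T0 : (0 < #|T|)%N.
Variable J : finType.
Implicit Types (F : {ffun J -> T} -> R) (w v : {ffun J -> T}).

Lemma card_ffun_gt0 : (0 < #|{ffun J -> T}|)%N.
Proof. by rewrite card_ffun expn_gt0 T0. Qed.

Definition mix (s : pred J) v w : {ffun J -> T} :=
  [ffun j => if s j then v j else w j].

Definition upd w i x : {ffun J -> T} := [ffun j => if j == i then x else w j].

Lemma upd_same w i x : upd w i x i = x.
Proof. by rewrite ffunE eqxx. Qed.

Lemma upd_other w i x j : j != i -> upd w i x j = w j.
Proof. by rewrite ffunE => /negPf ->. Qed.

Lemma upd_upd w i x y : upd (upd w i x) i y = upd w i y.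
Proof. by apply/ffunP => j; rewrite !ffunE; case: eqP. Qed.

Lemma updC w i j x y : i != j -> upd (upd w i x) j y = upd (upd w j y) i x.
Proof.
move=> ij; apply/ffunP => l; rewrite !ffunE.
by case: (l =P j) => // ->; rewrite eq_sym (negPf ij).
Qed.

Lemma upd_id w i : upd w i (w i) = w.
Proof. by apply/ffunP => l; rewrite ffunE; case: eqP => // ->. Qed.

(* [(v, w) |-> (mix s v w, mix s w v)] is an involution. *)
Lemma avg_mix s F : avg F = avg (fun w => avg (fun v => F (mix s v w))).
Proof.
pose h (p : {ffun J -> T} * {ffun J -> T}) := (mix s p.2 p.1, mix s p.1 p.2).
have hK : involutive h.
  by move=> [w v]; congr (_, _); apply/ffunP => j; rewrite !ffunE; case: (s j).
rewrite -(avg_pair (fun p => F (mix s p.2 p.1))).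
rewrite -(avg_bij (fun p => F (mix s p.2 p.1)) (inv_bij hK)) avg_pair /=.
apply: eq_avg => w; rewrite -[LHS](avg_const _ card_ffun_gt0).
by apply: eq_avg => v; congr F; apply/ffunP => j; rewrite !ffunE; case: (s j).
Qed.

Lemma avg_prod (f : J -> T -> R) :
  avg (fun v : {ffun J -> T} => \prod_j f j (v j)) = \prod_j avg (f j).
Proof.
rewrite /avg -bigA_distr_bigA big_split /= prodr_const card_ffun natrX.
by rewrite exprVn.
Qed.

Lemma avg_coord (j : J) (f : T -> R) :
  avg (fun v : {ffun J -> T} => f (v j)) = avg f.
Proof.
transitivity (avg (fun v : {ffun J -> T} =>
    \prod_i (if i == j then f (v i) else 1))).
  by apply: eq_avg => v; rewrite -big_mkcond big_pred1_eq.
rewrite (avg_prod (fun i x => if i == j then f x else 1)).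
rewrite (bigD1 j) //= eqxx big1 ?mulr1 // => i /negPf ij.
by under eq_avg do rewrite ij; rewrite avg_const.
Qed.

Lemma avg_upd (i : J) F : avg F = avg (fun w => avg (fun x => F (upd w i x))).
Proof.
rewrite (avg_mix (pred1 i)); apply: eq_avg => w.
rewrite -(avg_coord i (fun x => F (upd w i x))); apply: eq_avg => v.
by congr F; apply/ffunP => j; rewrite !ffunE /=; case: eqP => // ->.
Qed.

Lemma avg_coord_mem (i : J) (D : {set T}) :
  avg (fun w : {ffun J -> T} => (w i \in D)%:R) = #|D|%:R / #|T|%:R.
Proof.
rewrite (avg_coord i (fun x => (x \in D)%:R)) avg_pred.
by congr (_%:R / _); apply: eq_card.
Qed.

Lemma avg_coord_eq (i j : J) : i != j ->
  avg (fun w : {ffun J -> T} => (w i == w j)%:R) = #|T|%:R^-1.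
Proof.
move=> ij; have ji : j != i by rewrite eq_sym.
rewrite (avg_upd i).
rewrite -[RHS](avg_const _ card_ffun_gt0); apply: eq_avg => w.
under eq_avg => x do rewrite upd_same (upd_other _ _ ji).
by rewrite avg_pred (@eq_card1 _ (w j)) ?mul1r.
Qed.

(** Union bound over the pairs of coordinates that may coincide and the coordinates that may fall
    into [D]. *)
Lemma avg_avoid (D : {set T}) :
  1 - (#|J| * #|J| + #|J| * #|D|)%:R / #|T|%:R <=
  avg (fun w : {ffun J -> T} => (injectiveb w && [forall j, w j \notin D])%:R).
Proof.
pose B w := \sum_(p : J * J | p.1 != p.2) (w p.1 == w p.2)%:R +
            \sum_j (w j \in D)%:R : R.
apply: (@le_trans _ _ (avg (fun w => 1 - B w))); last first.
  apply: le_avg => w.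
  have B0 : 0 <= B w.
    by rewrite addr_ge0 ?sumr_ge0 // => *; rewrite ler0n.
  case: (boolP (_ && _)) => [_|nw]; first by rewrite lerBlDr lerDl.
  suff : 1 <= B w by move=> /=; lra.
  move: nw => /nandP[|]; rewrite /B.
    case/injectivePn => i [j ij wij]; rewrite (bigD1 (i, j)) //= wij eqxx -addrA.
    by rewrite lerDl addr_ge0 ?sumr_ge0 // => *; rewrite ler0n.
  case/forallPn => j; rewrite negbK => jD.
  rewrite addrC (bigD1 j) //= jD -addrA.
  by rewrite lerDl addr_ge0 ?sumr_ge0 // => *; rewrite ler0n.
rewrite avgB avg_const ?card_ffun_gt0 // lerD2l lerN2 avgD !avg_sum.
rewrite natrD mulrDl; apply: lerD.
  under eq_bigr => p pn do rewrite avg_coord_eq //.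
  rewrite sumr_const -[X in X <= _]mulr_natl ler_wpM2r ?invr_ge0 ?ler0n // ler_nat.
  by rewrite -card_prod max_card.
under eq_bigr => p _ do rewrite avg_coord_mem.
by rewrite sumr_const -[X in X <= _]mulr_natl mulrA -natrM.
Qed.

End Resampling.

Lemma avg_curry (T A B : finType) (F : {ffun A * B -> T} -> R) :
  avg F = avg (fun W : {ffun A -> {ffun B -> T}} =>
                 F [ffun p => W p.1 p.2]).
Proof.
pose h (W : {ffun A -> {ffun B -> T}}) : {ffun A * B -> T} :=
  [ffun p => W p.1 p.2].
pose g (w : {ffun A * B -> T}) : {ffun A -> {ffun B -> T}} :=
  [ffun a => [ffun b => w (a, b)]].
rewrite -(@avg_bij _ _ h F) //; exists g.
  by move=> W; apply/ffunP => a; apply/ffunP => b; rewrite !ffunE.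
by move=> w; apply/ffunP => -[a b]; rewrite !ffunE.
Qed.

End Average.

(** * Blow-ups in dense k-graphs *)

Section BlowUp.
Variables (T : finType) (k : nat).
Implicit Types (G : pred {ffun 'I_k -> T}) (f : {ffun 'I_k -> T}).

Definition selection m (w : {ffun 'I_m * 'I_k -> T}) (c : {ffun 'I_k -> 'I_m}) :
  {ffun 'I_k -> T} := [ffun i => w (c i, i)].

(** The entries of [w] may coincide, so this describes homomorphic images of K(m, ..., m);
    injectivity is obtained separately. *)
Definition complete m G (w : {ffun 'I_m * 'I_k -> T}) : bool :=
  [forall c, G (selection w c)].

Section Density.
Variables (R : realType) (m : nat) (G : pred {ffun 'I_k -> T}).
Hypothesis T0 : (0 < #|T|)%N.
Implicit Types w v : {ffun 'I_m.+1 * 'I_k -> T}.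

(* Only the coordinates in [s] have been blown up; for the others just the
   entries [w (ord0, i)] matter. *)
Definition partial_complete (s : seq 'I_k) w : bool :=
  [forall c : {ffun 'I_k -> 'I_m.+1},
     [forall i, (i \in s) || (c i == ord0)] ==> G (selection w c)].

Lemma partial_completeP s w :
  reflect (forall c : {ffun 'I_k -> 'I_m.+1},
             (forall i, i \notin s -> c i = ord0) -> G (selection w c))
          (partial_complete s w).
Proof.
apply: (iffP forallP) => [wG c c0|wG c].
  apply: (implyP (wG c)); apply/forallP => i.
  by case: (boolP (i \in s)) => //= /c0 ->.
apply/implyP => /forallP c0; apply: wG => i /negPf si.
by have := c0 i; rewrite si => /eqP.
Qed.

Lemma partial_complete_cons s i w : i \notin s ->
  (forall j, partial_complete s (upd w (ord0, i) (w (j, i)))) ->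
  partial_complete (i :: s) w.
Proof.
move=> si wG; apply/partial_completeP => c c0.
have /partial_completeP/(_ (upd c i ord0)) := wG (c i).
suff -> : selection (upd w (ord0, i) (w (c i, i))) (upd c i ord0) =
          selection w c.
  apply=> l sl; rewrite ffunE; case: (l =P i) => // /eqP li.
  by apply: c0; rewrite inE negb_or li.
apply/ffunP => l; rewrite !ffunE; case: (l =P i) => [->|/eqP/negPf li].
  by rewrite eqxx.
by rewrite xpair_eqE li andbF.
Qed.

Lemma partial_complete_mix s i w v x : i \notin s ->
  partial_complete s (upd w (ord0, i) x) ->
  partial_complete s (upd (mix (fun p => p.2 == i) v w) (ord0, i) x).
Proof.
move=> si /partial_completeP wG; apply/partial_completeP => c c0.
suff -> : selection (upd (mix (fun p => p.2 == i) v w) (ord0, i) x) c =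
          selection (upd w (ord0, i) x) c by apply: wG.
apply/ffunP => l; rewrite !ffunE /= xpair_eqE.
by case: (l =P i) => [->|_]; [rewrite c0 ?eqxx | rewrite andbF].
Qed.

(** Columns are blown up one at a time. With the other columns fixed, the [m.+1] entries of column
    [i] are independent, so all of them are good with the [m.+1]-st power of a conditional
    probability. Jensen bounds its average from below, and each column multiplies the exponent by
    [m.+1]. *)
Lemma partial_complete_density (d : R) s : uniq s -> 0 <= d ->
  d <= avg (fun f => (G f)%:R) ->
  d ^+ (m.+1 ^ size s) <= avg (fun w => (partial_complete s w)%:R).
Proof.
move=> us d0 dG; elim: s us => [_|i s IHs /andP[si /IHs{}IHs]] /=.
  rewrite expn0 expr1; apply: le_trans dG _.
  rewrite avg_curry -(avg_coord (card_ffun_gt0 T0 _) (ord0 : 'I_m.+1)).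
  apply: le_avg => W; rewrite ler_nat.
  case: (boolP (G _)) => //= GW; rewrite lt0b; apply/partial_completeP => c c0.
  suff -> : selection [ffun p => W p.1 p.2] c = W ord0 by [].
  by apply/ffunP => l; rewrite !ffunE /= c0.
pose a w x := partial_complete s (upd w (ord0, i) x).
rewrite expnSr exprM; apply: (@le_trans _ _ (avg (fun w => (partial_complete s w)%:R) ^+ m.+1)).
  by rewrite lerXn2r ?nnegrE ?exprn_ge0 ?avg_ge0.
rewrite (avg_upd T0 (ord0, i)).
apply: le_trans (avg_pow _ _ _) _; first exact: card_ffun_gt0.
  by move=> w; apply: avg_ge0 => x; rewrite ler0n.
rewrite [leRHS](avg_mix T0 (fun p => p.2 == i)).
apply: le_avg => w.
(* The power is written as a product over all coordinates, with factor 1 outside column [i], so that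
   [avg_prod] turns it into an average over a fresh array [v]. *)
have -> : avg (fun x => (a w x)%:R : R) ^+ m.+1 =
  \prod_(p : 'I_m.+1 * 'I_k) avg (fun x => if p.2 == i then (a w x)%:R else 1).
  rewrite -(pair_bigA_idem _ (fun j l => avg (fun x => if l == i then (a w x)%:R else 1))) /=.
  2: by rewrite mulr1.
  rewrite (eq_bigr (fun _ => avg (fun x => (a w x)%:R))) ?prodr_const ?card_ord //.
  move=> j _; rewrite (bigD1 i) //= eqxx big1 ?mulr1 // => l /negPf li.
  by rewrite li avg_const.
rewrite -(avg_prod (fun p x => if p.2 == i then (a w x)%:R else 1)).
apply: le_avg => v.
case: (boolP [forall j, a w (v (j, i))]) => [/forallP av|].
  have -> : partial_complete (i :: s) (mix (fun p => p.2 == i) v w).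
    apply: partial_complete_cons => // j.
    by rewrite [mix _ _ _ (j, i)]ffunE /= eqxx partial_complete_mix //; apply: av.
  apply: prodr_ile1 => p _.
  by case: ifP => _; rewrite ?ler01 ?lexx // ler0n lern1 leq_b1.
case/forallPn => j /negPf avj; rewrite (bigD1 (j, i)) //= eqxx avj mul0r.
by rewrite ler0n.
Qed.

End Density.

Lemma complete_density (R : realType) m G (d : R) : (0 < #|T|)%N -> 0 <= d ->
  d <= avg (fun f => (G f)%:R) ->
  d ^+ (m.+1 ^ k) <= avg (fun w : {ffun 'I_m.+1 * 'I_k -> T} => (complete G w)%:R).
Proof.
move=> T0 d0 dG; have := partial_complete_density m T0 (enum_uniq 'I_k) d0 dG.
rewrite size_enum_ord => /le_trans; apply; apply: le_avg => w.
rewrite ler_nat; case: (boolP (partial_complete _ _ _)) => // /partial_completeP wG.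
by rewrite lt0b; apply/forallP => c; apply: wG => i; rewrite mem_enum.
Qed.

End BlowUp.

Lemma archi_large (R : realType) (a b : R) : 0 < b ->
  exists n0, forall n, (n0 <= n)%N -> a <= b * n%:R.
Proof.
move=> b0; exists (Num.truncn (a / b)).+1 => n nn.
rewrite mulrC -ler_pdivrMr //.
by apply: le_trans (ltW (truncnS_gt _)) _; rewrite ler_nat.
Qed.

(* A theorem of Erdos. *)
Lemma dense_complete (R : realType) (k M : nat) (d : R) : 0 < d ->
  exists n0, forall (T : finType) (G : pred {ffun 'I_k -> T}), (n0 <= #|T|)%N ->
    d <= avg (fun f => (G f)%:R) ->
    exists D : 'I_k -> {set T}, (forall i, #|D i| = M) /\
      forall f : {ffun 'I_k -> T}, (forall i, f i \in D i) -> G f.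
Proof.
move=> d0; pose J := ('I_M.+1 * 'I_k)%type.
have [n0 n0P] := archi_large ((#|{: J}| * #|{: J}|)%:R + 1) (exprn_gt0 (M.+1 ^ k) d0).
exists n0.+1 => T G nT dG; have T0 : (0 < #|T|)%N by lia.
(* The density of complete arrays exceeds the probability of a collision, so the sum of the two
   indicators averages to more than 1 and some array satisfies both. *)
have [w] : exists w : {ffun J -> T}, 1 < (complete G w)%:R +
    (injectiveb w && [forall j, w j \notin set0])%:R :> R.
  have cG := complete_density M T0 (ltW d0) dG.
  have inj := avg_avoid R T0 J set0; rewrite cards0 muln0 addn0 in inj.
  have := lerD cG inj; rewrite -avgD => /(avg_ex (card_ffun_gt0 T0 _))[w ww].
  exists w; apply: lt_le_trans ww; rewrite addrCA ltrDl subr_gt0.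
  rewrite ltr_pdivrMr ?ltr0n //; apply: lt_le_trans (n0P _ (ltnW nT)).
  by rewrite ltrDl.
case: (boolP (complete _ _)) => [/forallP wG|_]; last first.
  by case: (_ && _); rewrite /= add0r ?mulr1n ?ltxx // ltr10.
case: (boolP (injectiveb w)) => [/injectiveP wI _|]; last by rewrite /= addr0 mulr1n ltxx.
(* The blow-up has [M.+1] entries per part; the last one is dropped. *)
pose e : 'I_M -> 'I_M.+1 := widen_ord (leqnSn M).
exists (fun i => [set w (e j, i) | j : 'I_M]); split=> [i|f fD].
  rewrite card_imset ?card_ord // => j j' /wI[] jj'; exact: val_inj.
have c i : {j | f i = w (e j, i)}.
  by apply: sig_eqW; have /imsetP[j _ ->] := fD i; exists j.
have := wG [ffun i => e (sval (c i))]; congr (is_true (G _)).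
by apply/ffunP => i; rewrite !ffunE; case: (c i).
Qed.

(** * Tilings *)

Lemma disjointP (V : finType) (A B : {set V}) :
  reflect (forall v, v \in A -> v \in B -> False) [disjoint A & B].
Proof.
rewrite -setI_eq0; apply: (iffP eqP) => [AB v vA vB|AB].
  by have := in_set0 v; rewrite -AB inE vA vB.
by apply/setP => v; rewrite !inE; apply/negP => /andP[/AB].
Qed.

Lemma exists_subset (T : finType) (A : {set T}) n : (n <= #|A|)%N ->
  exists B : {set T}, B \subset A /\ #|B| = n.
Proof.
move=> nA; exists [set x in take n (enum A)]; split.
  by apply/subsetP => x; rewrite inE => /mem_take; rewrite mem_enum.
rewrite cardsE; have /card_uniqP -> : uniq (take n (enum A)).
  by rewrite take_uniq ?enum_uniq.
by rewrite size_takel // -cardE.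
Qed.

Lemma sum_setU (R : realType) (V : finType) (A B : {set V}) (phi : V -> R) :
  [disjoint A & B] ->
  \sum_(v in A :|: B) phi v = \sum_(v in A) phi v + \sum_(v in B) phi v.
Proof.
by move=> dAB; rewrite -bigU //; apply: eq_bigl => v; rewrite !inE.
Qed.

(* Vertices are pairs (part, element): part [i] of [A] is [sec A i]. *)
Section Tilings.
Variables (T : finType) (k : nat) (E : pred {ffun 'I_k -> T}).
Local Notation V := ('I_k * T)%type.
Implicit Types (A B L : {set V}) (i l : 'I_k) (D : 'I_k -> {set T}).

Definition sec A i : {set T} := [set x | (i, x) \in A].
Definition fam D : {set V} := [set v | v.2 \in D v.1].

Lemma in_sec A i x : (x \in sec A i) = ((i, x) \in A).
Proof. by rewrite inE. Qed.

Lemma sec_fam D i : sec (fam D) i = D i.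
Proof. by apply/setP => x; rewrite !inE. Qed.

Lemma sec0 i : sec set0 i = set0.
Proof. by apply/setP => x; rewrite !inE. Qed.

Lemma secT i : sec setT i = setT.
Proof. by apply/setP => x; rewrite !inE. Qed.

Lemma secU A B i : sec (A :|: B) i = sec A i :|: sec B i.
Proof. by apply/setP => x; rewrite !inE. Qed.

Lemma secD A B i : sec (A :\: B) i = sec A i :\: sec B i.
Proof. by apply/setP => x; rewrite !inE. Qed.

Lemma secS A B i : A \subset B -> sec A i \subset sec B i.
Proof. by move=> /subsetP AB; apply/subsetP => x; rewrite !inE => /AB. Qed.

Lemma fam_sub A D : (forall i, D i \subset sec A i) -> fam D \subset A.
Proof.
move=> DA; apply/subsetP => -[i x]; rewrite inE /= => xD.
by have := subsetP (DA i) x xD; rewrite inE.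
Qed.

Lemma card_secU A B i : [disjoint A & B] ->
  #|sec (A :|: B) i| = (#|sec A i| + #|sec B i|)%N.
Proof.
move=> /disjointP AB; rewrite secU cardsU.
suff -> : sec A i :&: sec B i = set0 by rewrite cards0 subn0.
by apply/setP => x; rewrite !inE; apply/negP => /andP[/AB].
Qed.

Lemma card_secD A B i : B \subset A ->
  #|sec (A :\: B) i| = (#|sec A i| - #|sec B i|)%N.
Proof.
by move=> BA; rewrite secD cardsD (setIidPr (secS i BA)).
Qed.

Lemma exists_subfam D n : (forall i, (n <= #|D i|)%N) ->
  exists D', forall i, D' i \subset D i /\ #|D' i| = n.
Proof.
move=> nD; have h i : {B : {set T} | (B \subset D i) && (#|B| == n)}.
  apply: sigW; have [B [BD Bn]] := exists_subset (nD i).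
  by exists B; rewrite BD Bn eqxx.
by exists (fun i => sval (h i)) => i; case: (h i) => /= B /andP[-> /eqP].
Qed.

Definition tile M B : Prop := (forall i, #|sec B i| = M) /\
  forall f : {ffun 'I_k -> T}, (forall i, f i \in sec B i) -> E f.

Inductive tiled M : {set V} -> Prop :=
| Tiled0 : tiled M set0
| TiledU A B : tiled M A -> tile M B -> [disjoint A & B] -> tiled M (A :|: B).

Lemma tiled_tile M B : tile M B -> tiled M B.
Proof.
by move=> tB; rewrite -[B]set0U; apply: TiledU => //; [left | rewrite -setI_eq0 set0I].
Qed.

Lemma tiled_setU M A B : tiled M A -> tiled M B -> [disjoint A & B] ->
  tiled M (A :|: B).
Proof.
move=> tA; elim=> [_|B1 B2 tB1 IH tB2 dB /disjointP dA]; first by rewrite setU0.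
rewrite setUA; apply: TiledU => //.
  by apply: IH; apply/disjointP => v vA vB; apply: (dA v); rewrite // inE vB.
apply/disjointP => v; rewrite inE => /orP[vA|vB] vB2.
  by apply: (dA v); rewrite // inE vB2 orbT.
by move/disjointP: dB => /(_ v vB vB2).
Qed.

Lemma tiled_card M A : tiled M A -> exists c, forall i, #|sec A i| = (c * M)%N.
Proof.
elim=> [|{}A B tA [c cA] [cB _] dAB]; first by exists 0 => i; rewrite sec0 cards0.
by exists c.+1 => i; rewrite card_secU // cA cB mulSn addnC.
Qed.

Lemma tile_sub M M' B B' : tile M B -> B' \subset B ->
  (forall i, #|sec B' i| = M') -> tile M' B'.
Proof.
move=> [_ tB] BB' cB'; split=> // f fB'; apply: tB => i.
exact: (subsetP (secS i BB')).
Qed.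

Lemma tile_split q M B : tile (q * M) B -> tiled M B.
Proof.
elim: q B => [|q IHq] B tB.
  rewrite (_ : B = set0); first by left.
  apply/setP => -[i x]; rewrite -in_sec in_set0.
  by have /cards0_eq -> := tB.1 i; rewrite inE.
have [D DP] : exists D, forall i, D i \subset sec B i /\ #|D i| = M.
  by apply: exists_subfam => i; rewrite tB.1 mulSn leq_addr.
have DB : fam D \subset B by apply: fam_sub => i; case: (DP i).
rewrite -[B](setID _ (fam D)) setUC (setIidPr DB).
have cD i : #|sec (fam D) i| = M by rewrite sec_fam; case: (DP i).
apply: TiledU; last first.
- by rewrite disjoint_sym disjoints_subset; apply/subsetP => v; rewrite !inE => ->.
- exact: tile_sub tB DB cD.
apply: IHq; apply: (tile_sub tB); first exact: subsetDl.
by move=> i; rewrite card_secD // cD tB.1 mulSn addKn.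
Qed.

Lemma tiled_refine q M A : tiled (q * M) A -> tiled M A.
Proof.
elim=> [|{}A B _ tA tB dAB]; first by left.
by apply: tiled_setU => //; apply: tile_split tB.
Qed.

(** Otherwise every tile would weigh at most [c * M]; as each tile takes [M] vertices of part [i],
    whichever part this is, the total would be at most [c] times the size of that part of [A]. *)
Lemma tiled_heavy_tile (R : realType) (phi : V -> R) (c : R) M A i : tiled M A ->
  c * #|sec A i|%:R < \sum_(v in A) phi v ->
  exists A' B, [/\ tiled M A', tile M B, [disjoint A' & B], A = A' :|: B &
    c * M%:R < \sum_(v in B) phi v].
Proof.
elim=> [|{}A B tA IH tB dAB].
  by rewrite sec0 cards0 mulr0 big_set0 ltxx.
rewrite card_secU // sum_setU // natrD mulrDr tB.1 => lt_phi.
case: (ltP (c * M%:R) (\sum_(v in B) phi v)) => [ltB|leB].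
  by exists A, B.
have /IH[A' [B' [tA' tB' d' eqA ltB']]] :
    c * #|sec A i|%:R < \sum_(v in A) phi v by lra.
have [dA'B dB'B] : [disjoint A' & B] /\ [disjoint B' & B].
  move: dAB; rewrite eqA => /disjointP d.
  by split; apply/disjointP => v v1; apply: d; rewrite inE v1 ?orbT.
exists (A' :|: B), B'; split=> //; first exact: TiledU.
  apply/disjointP => v; rewrite inE => /orP[vA'|vB] vB'.
    by move/disjointP: d' => /(_ v vA' vB').
  by move/disjointP: dB'B => /(_ v vB' vB).
by rewrite eqA -!setUA (setUC B).
Qed.

Lemma tile_swap M i (C : {set T}) D : (0 < M)%N -> #|C| = M ->
  (forall l, #|D l| = M) ->
  (forall (f : {ffun 'I_k -> T}) x, (forall l, f l \in D l) -> x \in C -> E (upd f i x)) ->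
  tile M (fam (fun l => if l == i then C else D l)).
Proof.
move=> M0 cC cD ED; split=> [l|f fX]; first by rewrite sec_fam; case: eqP.
have /card_gt0P[y yD] : (0 < #|D i|)%N by rewrite cD.
rewrite -(upd_id f i) -(upd_upd f i y); apply: ED => [l|]; last first.
  by have := fX i; rewrite sec_fam eqxx.
rewrite ffunE; case: eqP => [->//|/eqP li].
by have := fX l; rewrite sec_fam (negPf li).
Qed.

(* One tile of size [M] together with part of [L] becomes tiles of size [M']
   covering [M + M'] vertices of each part: two tiles have one part inside [B]
   and the others in [L], the rest of [B] keeps size [M - M']. *)
Lemma tile_improve M M' B L i i' (C C' : {set T}) D D' :
  tile M B -> [disjoint B & L] -> i != i' -> (0 < M')%N -> (M' <= M)%N ->
  (M' %| M)%N ->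
  C \subset sec B i -> C' \subset sec B i' -> #|C| = M' -> #|C'| = M' ->
  (forall l, D l \subset sec L l) -> (forall l, D' l \subset sec L l) ->
  (forall l, #|D l| = (2 * M')%N) -> (forall l, #|D' l| = (2 * M')%N) ->
  (forall (f : {ffun 'I_k -> T}) x, (forall l, f l \in D l) -> x \in C -> E (upd f i x)) ->
  (forall (f : {ffun 'I_k -> T}) x, (forall l, f l \in D' l) -> x \in C' -> E (upd f i' x)) ->
  exists A, [/\ tiled M' A, A \subset B :|: L & forall l, #|sec A l| = (M + M')%N].
Proof.
move=> tB dBL ii' M'0 M'M dvM CB CB' cC cC' DL DL' cD cD' ED ED'.
have [D1 D1P] : exists D1, forall l, D1 l \subset D l /\ #|D1 l| = M'.
  by apply: exists_subfam => l; rewrite cD; lia.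
(* The sets [D' l] have size [2 * M'], so at least [M'] elements remain after the removal of
   [D1 l]. *)
have [D2 D2P] : exists D2, forall l, D2 l \subset D' l :\: D1 l /\ #|D2 l| = M'.
  apply: exists_subfam => l; rewrite cardsD cD'.
  have := subset_leq_card (subsetIr (D' l) (D1 l)); rewrite (D1P l).2; lia.
pose X1 := fam (fun l => if l == i then C else D1 l).
pose X2 := fam (fun l => if l == i' then C' else D2 l).
have D1x l x : x \in D1 l -> x \in D l by apply/subsetP; case: (D1P l).
have D2x l x : x \in D2 l -> x \in D' l /\ x \notin D1 l.
  by move=> /(subsetP (D2P l).1); rewrite inE => /andP[].
have BL l x : x \in sec B l -> x \in sec L l -> False.
  by rewrite !in_sec; move/disjointP: dBL; apply.
have D1L l x : x \in D1 l -> x \in sec L l by move=> /D1x /(subsetP (DL l)).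
have D2L l x : x \in D2 l -> x \in sec L l by move=> /D2x[/(subsetP (DL' l))].
have CBx x : x \in C -> x \in sec B i by apply/subsetP.
have CBx' x : x \in C' -> x \in sec B i' by apply/subsetP.
have tX1 : tile M' X1.
  apply: tile_swap => // [l|f x fD]; first by case: (D1P l).
  by apply: ED => l; apply: D1x.
have tX2 : tile M' X2.
  apply: tile_swap => // [l|f x fD]; first by case: (D2P l).
  by apply: ED' => l; case: (D2x _ _ (fD l)).
have dX : [disjoint X1 & X2].
  apply/disjointP => -[l x]; rewrite !inE /=; case: (l =P i) => [->|_].
    by rewrite (negPf ii') => /CBx xB /D2L; apply: BL.
  case: (l =P i') => [->|_]; first by move=> /D1L xL /CBx' /BL; apply.
  by move=> xD1 /D2x[_]; rewrite xD1.
have [D3 D3P] : exists D3, forall l,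
    D3 l \subset sec (B :\: (X1 :|: X2)) l /\ #|D3 l| = (M - M')%N.
  apply: exists_subfam => l; rewrite secD cardsD tB.1 leq_sub2l //.
  (* The two new tiles meet part [l] of [B] inside [C], inside [C'], or not at all; in the last case
     [D1 l] is just some set of size [M']. *)
  have [l0 [cl0 sub_l0]] : exists S : {set T}, #|S| = M' /\
      sec B l :&: sec (X1 :|: X2) l \subset S.
    exists (if l == i then C else if l == i' then C' else D1 l).
    split; first by do 2?case: eqP => // _; case: (D1P l).
    apply/subsetP => x; rewrite in_setI secU in_setU !sec_fam => /andP[xB].
    case: (l =P i) => [li|_].
      by rewrite li (negPf ii') => /orP[//|/D2L]; rewrite -li => /(BL _ _ xB).
    case: (l =P i') => [_|_].
      by case/orP => // /D1L/(BL _ _ xB).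
    by case/orP => [/D1L|/D2L] /(BL _ _ xB).
  by rewrite -cl0; apply: subset_leq_card.
have D3B : fam D3 \subset B :\: (X1 :|: X2) by apply: fam_sub => l; case: (D3P l).
have cX3 l : #|sec (fam D3) l| = (M - M')%N by rewrite sec_fam; case: (D3P l).
have tX3 : tiled M' (fam D3).
  apply: (@tile_split ((M - M') %/ M')); rewrite divnK ?dvdn_sub //.
  by apply: (tile_sub tB _ cX3); apply: subset_trans D3B (subsetDl _ _).
have d12 : [disjoint X1 :|: X2 & fam D3].
  apply/disjointP => v vX /(subsetP D3B); by rewrite inE vX.
exists (X1 :|: X2 :|: fam D3); split.
- apply: tiled_setU => //; apply: tiled_setU => //; exact: tiled_tile.
- rewrite !subUset -andbA; apply/and3P; split.
  + apply: fam_sub => l; rewrite secU; apply/subsetP => x; rewrite in_setU.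
    by case: eqP => [-> /CBx ->//|_ /D1L ->]; rewrite orbT.
  + apply: fam_sub => l; rewrite secU; apply/subsetP => x; rewrite in_setU.
    by case: eqP => [-> /CBx' ->//|_ /D2L ->]; rewrite orbT.
  + apply: subset_trans D3B _; apply: subset_trans (subsetDl _ _) (subsetUl _ _).
by move=> l; rewrite !card_secU // tX1.1 tX2.1 cX3; lia.
Qed.

End Tilings.

(** * Almost perfect tilings *)

Section AlmostTiling.
Variables (R : realType) (k : nat).

(** If at most one [s i] reached [rho * Z], the sum would be at most [Z] plus [k] terms of size
    [rho * Z]. *)
Lemma two_heavy (s : 'I_k -> R) (Z rho : R) : 0 < Z -> 0 < rho ->
  (forall i, s i <= Z) -> (1 + k%:R * rho) * Z < \sum_i s i ->
  exists i j, [/\ i != j, rho * Z <= s i & rho * Z <= s j].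
Proof.
move=> Z0 rho0 sZ big.
have sum_rho (P : pred 'I_k) : (forall i, P i -> s i < rho * Z) ->
    \sum_(i | P i) s i <= k%:R * rho * Z.
  move=> small; rewrite -mulrA.
  apply: (@le_trans _ _ (\sum_(i | P i) rho * Z)).
    by apply: ler_sum => i /small /ltW.
  rewrite sumr_const -[X in X <= _]mulr_natl; apply: ler_wpM2r.
    by rewrite ltW ?mulr_gt0.
  by rewrite ler_nat (leq_trans (max_card _)) ?card_ord.
have [/existsP[i hi]|/existsPn no] := boolP [exists i, rho * Z <= s i]; last first.
  exfalso; have : \sum_i s i <= k%:R * rho * Z by apply: sum_rho => i _; rewrite ltNge no.
  nra.
have [/existsP[j /andP[ji hj]]|/existsPn no] :=
    boolP [exists j, (j != i) && (rho * Z <= s j)].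
  by exists i, j; rewrite eq_sym.
move: big; rewrite (bigD1 i) //= => big; exfalso.
have : \sum_(j | j != i) s j <= k%:R * rho * Z.
  by apply: sum_rho => j ji; rewrite ltNge; have := no j; rewrite ji.
have := sZ i; nra.
Qed.

Section Density.
Variables (T : finType) (E : pred {ffun 'I_k -> T}).
Hypothesis T0 : (0 < #|T|)%N.
Local Notation V := ('I_k * T)%type.
Implicit Types (A B L : {set V}) (i l : 'I_k) (D : 'I_k -> {set T}) (f : {ffun 'I_k -> T}).

Definition inside L (f : {ffun 'I_k -> T}) := [forall l, f l \in sec L l].

Lemma insideP L f : reflect (forall l, f l \in sec L l) (inside L f).
Proof. exact: forallP. Qed.

Lemma avg_inside L (u : nat) : (forall l, #|sec L l| = u) ->
  avg (fun f => (inside L f)%:R : R) = (u%:R / #|T|%:R) ^+ k.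
Proof.
move=> cL; pose g l x : R := (x \in sec L l)%:R.
transitivity (avg (fun f : {ffun 'I_k -> T} => \prod_l g l (f l))).
  apply: eq_avg => f; case: insideP => [fL|nf].
    by rewrite big1 // => l _; rewrite /g fL.
  have [l nfl] : exists l, f l \notin sec L l.
    by apply/existsP; apply: contra_notT nf => /existsPn h l; rewrite -[_ \in _]negbK.
  by rewrite (bigD1 l) //= /g (negPf nfl) mul0r.
rewrite avg_prod; under eq_bigr => l _ do
  rewrite /g (avg_pred R (mem (sec L l))) cL.
by rewrite prodr_const card_ord.
Qed.

(** Up to normalisation, the number of (k-1)-tuples of [L] that form an edge with [x]. The entry
    [f i] is overwritten, yet confined to [L], so that the densities for all parts have the same
    upper bound: the probability that [f] lies inside [L]. *)
Definition link_density L i x : R := avg (fun f => (inside L f && E (upd f i x))%:R).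

Lemma link_density_le L i x : link_density L i x <= avg (fun f => (inside L f)%:R).
Proof. by apply: le_avg => f; rewrite ler_nat; case: (inside L f); case: (E _). Qed.

Lemma sum_link_density_le L i (X : {set T}) :
  \sum_(x in X) link_density L i x <= #|X|%:R * avg (fun f => (inside L f)%:R).
Proof.
rewrite mulr_natl -sumr_const; apply: ler_sum => x _; exact: link_density_le.
Qed.

Lemma sum_link_density L i (X : {set T}) :
  \sum_(x in X) link_density L i x =
  avg (fun f => (inside L f)%:R * #|[set x in X | E (upd f i x)]|%:R).
Proof.
rewrite -avg_sum; apply: eq_avg => f; case: (inside L f); last first.
  by rewrite mul0r big1.
by rewrite mul1r -natr_sum -big_mkcondr sum1_card /=; congr _%:R; apply: eq_card => x; rewrite !inE.
Qed.

Lemma sum_link_density_self L i :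
  \sum_(x in sec L i) link_density L i x <=
  #|T|%:R * avg (fun f => (inside L f && E f)%:R).
Proof.
rewrite [X in _ * X](avg_upd T0 i) -avg_sum -avgZl; apply: le_avg => f.
rewrite /avg mulrCA mulfV ?pnatr_eq0 -?lt0n // mulr1.
rewrite [leRHS](bigID (mem (sec L i))) /=.
apply: ler_wpDr; first by rewrite sumr_ge0 // => x _; rewrite ler0n.
apply: ler_sum => x xL; rewrite ler_nat.
case: (boolP (inside L f)) => // /insideP fL.
suff -> : inside L (upd f i x) by [].
by apply/insideP => l; rewrite ffunE; case: eqP => [->|].
Qed.

Lemma sum_sec A (phi : V -> R) :
  \sum_(v in A) phi v = \sum_i \sum_(x in sec A i) phi (i, x).
Proof. by rewrite pair_big_dep; apply: eq_big => -[i x]; rewrite ?inE. Qed.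

(* Pigeonhole over the subsets [C] of [X]. *)
Lemma heavy_subset L i (X : {set T}) (M M' : nat) (rho : R) :
  let Lam := avg (fun f => (inside L f)%:R) in
  #|X| = M -> (0 < M)%N -> 0 < rho -> 0 < Lam -> 2 * M'%:R <= rho * M%:R ->
  rho * (M%:R * Lam) <= \sum_(x in X) link_density L i x ->
  exists C : {set T}, [/\ C \subset X, #|C| = M' &
    rho * Lam / 4 / (2 ^ M)%:R <=
    avg (fun f => (inside L f && [forall (x | x \in C), E (upd f i x)])%:R)].
Proof.
move=> Lam cX M0 rho0 Lam0 M'M; rewrite sum_link_density => heavy.
pose g (C : {set T}) := avg (fun f => (inside L f && [forall (x | x \in C), E (upd f i x)])%:R) : R.
set c := rho * Lam / 4 / _.
have [/existsP[C /and3P[CX /eqP cC gC]]|/existsPn no] :=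
    boolP [exists C : {set T}, [&& C \subset X, #|C| == M' & c <= g C]].
  by exists C.
have c0 : 0 <= c.
  by rewrite /c divr_ge0 ?ler0n // divr_ge0 // mulr_ge0 // ltW.
exfalso; pose P (C : {set T}) := (C \subset X) && (#|C| == M').
(* If no [C] qualified, the at most [2 ^ M] subsets would contribute at most [rho * Lam / 4]
   together. A function with fewer than [M'] neighbours in [X] contributes at most [M'] to the link
   sum; any other contributes at most [M] and is counted by some [C]. In total this is at most 3/4
   of the assumed lower bound. *)
have le1 : \sum_(C | P C) g C <= rho * Lam / 4.
  apply: (@le_trans _ _ (\sum_(C in powerset X) c)).
    rewrite [leRHS](bigID P) /= (eq_bigl (fun C => (C \in powerset X) && P C)).
      apply: ler_wpDr.
        by rewrite sumr_ge0.
      apply: ler_sum => C /andP[_ /andP[CX cC]].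
      by have := no C; rewrite CX cC /= -ltNge => /ltW.
    by move=> C; rewrite powersetE /P; case: (C \subset X).
  rewrite sumr_const card_powerset cX -[X in X <= _]mulr_natl /c mulrC divfK //.
  by rewrite pnatr_eq0 expn_eq0.
have le2 : avg (fun f => (inside L f)%:R * #|[set x in X | E (upd f i x)]|%:R)
    <= M'%:R * Lam + M%:R * \sum_(C | P C) g C.
  rewrite -avgZl -avg_sum -avgZl -avgD; apply: le_avg => f.
  case: (inside L f); last by rewrite mul0r mulr0 add0r mulr_ge0 ?sumr_ge0 // => *; rewrite ler0n.
  rewrite mul1r mulr1; set N := [set x in X | _].
  have NX : N \subset X by apply/subsetP => x; rewrite inE => /andP[].
  case: (leqP M' #|N|) => [/exists_subset[C [CN cC]]|/ltnW ltN]; last first.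
    by apply: ler_wpDr; rewrite ?ler_nat // mulr_ge0 ?sumr_ge0 // => *; rewrite ler0n.
  apply: ler_wpDl; first by rewrite ler0n.
  apply: (@le_trans _ _ (M%:R * 1)).
    by rewrite mulr1 ler_nat -cX subset_leq_card.
  rewrite ler_wpM2l ?ler0n // (bigD1 C) /=; last first.
    by rewrite /P cC eqxx (subset_trans CN NX).
  have -> : [forall (x | x \in C), E (upd f i x)].
    by apply/forall_inP => x /(subsetP CN); rewrite inE => /andP[].
  by apply: ler_wpDr; rewrite ?sumr_ge0 // => *; rewrite ler0n.
have M1 : 0 < M%:R :> R by rewrite ltr0n.
have := le_trans heavy le2.
have : M'%:R * Lam <= rho * M%:R / 2 * Lam by apply: ler_wpM2r; [exact: ltW | lra].
have : M%:R * \sum_(C | P C) g C <= M%:R * (rho * Lam / 4)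
  by apply: ler_wpM2l; [exact: ltW | exact: le1].
have : 0 < rho * (M%:R * Lam) by apply: mulr_gt0 => //; apply: mulr_gt0.
lra.
Qed.

End Density.

(** [dense_complete] is applied to the edges inside [L]; since no [D i] is empty, each of its
    elements lies on a transversal, hence in [L]. *)
Lemma dense_complete_inside (M : nat) (d : R) : 0 < d -> (0 < M)%N ->
  exists n0, forall (T : finType) (G : pred {ffun 'I_k -> T}) (L : {set 'I_k * T}),
    (n0 <= #|T|)%N ->
    d <= avg (fun f : {ffun 'I_k -> T} => (inside L f && G f)%:R) ->
    exists D : 'I_k -> {set T}, [/\ forall i, #|D i| = M,
      forall i, D i \subset sec L i &
      forall f : {ffun 'I_k -> T}, (forall i, f i \in D i) -> G f].
Proof.
move=> d0 M0; have [n0 n0P] := dense_complete k M d0.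
exists n0 => T G L nT /(n0P _ (fun f => inside L f && G f) nT)[D [cD DG]].
exists D; split=> // [i|f /DG /andP[]//]; apply/subsetP => x xD.
have y l : {y | y \in D l}.
  by apply/sigW/card_gt0P; rewrite cD.
have /andP[/insideP/(_ i)] : inside L (upd [ffun l => sval (y l)] i x) &&
    G (upd [ffun l => sval (y l)] i x).
  by apply: DG => l; rewrite !ffunE; case: eqP => [->//|_]; case: (y l).
by rewrite upd_same.
Qed.

End AlmostTiling.

(** * Enlarging a tiling by passing to smaller tiles *)

Section Augmentation.
Variables (R : realType) (k : nat).
Hypothesis k3 : (3 <= k)%N.

(** The surplus over one half is absent here: it is spent on the vertices outside [U], which the
    absorbers occupy. *)
Definition codegree_into (T : finType) (E : pred {ffun 'I_k -> T}) (U : {set 'I_k * T}) :=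
  forall (f : {ffun 'I_k -> T}) i,
    #|T|%:R / 2 <= #|[set x in sec U i | E (upd f i x)]|%:R :> R.

Definition two_scale (T : finType) (E : pred {ffun 'I_k -> T}) (U : {set 'I_k * T})
    (M M' : nat) (A0 A1 : {set 'I_k * T}) :=
  [/\ A0 \subset U, A1 \subset U, [disjoint A0 & A1], tiled E M A0 & tiled E M' A1].

(* If [L] is sparse, the tiles of [A0] receive link density at least
   [k (1/2 - 2 rho)] in total, more than [1 + k rho] as [k >= 3] and
   [k rho = 1/12]; so some tile has two parts of density at least [rho]. *)
Lemma augment (eta rho : R) (M M' : nat) : 0 < eta -> 0 < rho ->
  k%:R * rho = 12^-1 -> (0 < M')%N -> (0 < M)%N -> (M' <= M)%N -> (M' %| M)%N ->
  2 * M'%:R <= rho * M%:R ->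
  exists n0, forall (T : finType) (E : pred {ffun 'I_k -> T}) (U A0 A1 : {set 'I_k * T}) u,
    (n0 <= #|T|)%N -> codegree_into E U -> two_scale E U M M' A0 A1 ->
    (forall i, #|sec (U :\: (A0 :|: A1)) i| = u) -> eta * #|T|%:R <= u%:R ->
    (forall i, #|sec A1 i|%:R <= rho * #|T|%:R) ->
    exists A0' A1', [/\ two_scale E U M M' A0' A1',
      forall i, (#|sec A0' i| + #|sec A1' i| = #|sec A0 i| + #|sec A1 i| + M')%N &
      forall i, (#|sec A1' i| <= #|sec A1 i| + (M + M'))%N].
Proof.
move=> eta0 rho0 krho M'0 M0 leM'M dvM'M M'M.
have etak : 0 < eta ^+ k by rewrite exprn_gt0.
pose d1 := rho * eta ^+ k; pose d2 := rho * eta ^+ k / 4 / (2 ^ M)%:R.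
have d1_gt0 : 0 < d1 by rewrite mulr_gt0.
have d2_gt0 : 0 < d2 by rewrite !divr_gt0 // ltr0n expn_gt0.
have M'2 : (0 < 2 * M')%N by lia.
have [n1 n1P] := dense_complete_inside k d1_gt0 M'0.
have [n2 n2P] := dense_complete_inside k d2_gt0 M'2.
exists (maxn 1 (maxn n1 n2)) => T E U A0 A1 u.
rewrite !geq_max => /and3P[T0 Tn1 Tn2] codeg [A0U A1U dA tA0 tA1] cL uT A1rho.
set L := U :\: (A0 :|: A1) in cL.
have LU : L \subset U by apply: subsetDl.
pose Lam : R := avg (fun f => (inside L f)%:R).
have N0 : 0 < #|T|%:R :> R by rewrite ltr0n.
have Lam_eta : eta ^+ k <= Lam.
  rewrite /Lam (avg_inside R cL) lerXn2r ?nnegrE ?ler_pdivlMr //; first exact: ltW.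
  by rewrite mul0r ler0n.
have Lam0 : 0 < Lam by apply: lt_le_trans Lam_eta.
have dL (X : {set 'I_k * T}) : X \subset L -> [disjoint A0 :|: A1 & X].
  by move=> XL; apply/disjointP => v vA /(subsetP XL); rewrite inE vA.
have [dense|sparse] := leP (rho * Lam) (avg (fun f => (inside L f && E f)%:R)).
  have [|D [cD DL DE]] := n1P T E L Tn1.
    by apply: le_trans dense; rewrite ler_wpM2l // ltW.
  have XL : fam D \subset L by apply: fam_sub.
  have dX := dL _ XL; have tX : tile E M' (fam D).
    by split=> [i|f fD]; [rewrite sec_fam | apply: DE => i; have := fD i; rewrite sec_fam].
  have [dX0 dX1] : [disjoint A0 & fam D] /\ [disjoint A1 & fam D].
    by move/disjointP: dX => dX; split; apply/disjointP => v vA; apply: dX; rewrite inE vA ?orbT.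
  exists A0, (A1 :|: fam D); split=> [|i|i].
  - split=> //; first by rewrite subUset A1U (subset_trans XL).
      apply/disjointP => v vA; rewrite inE => /orP[vA1|vX].
        by move/disjointP: dA => /(_ v vA vA1).
      by move/disjointP: dX0 => /(_ v vA vX).
    by apply: TiledU.
  - by rewrite card_secU // tX.1 addnA.
  - by rewrite card_secU // tX.1 leq_add2l leq_addl.
pose S i (X : {set T}) := \sum_(x in X) link_density R E L i x.
have SU i : #|T|%:R / 2 * Lam <= S i (sec U i).
  rewrite /S sum_link_density mulrC -avgZr; apply: le_avg => f.
  by rewrite ler_wpM2l ?ler0n.
have Ssplit i : S i (sec U i) = S i (sec A0 i) + S i (sec A1 i) + S i (sec L i).
  have -> : sec U i = (sec A0 i :|: sec A1 i) :|: sec L i.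
    rewrite -!secU; congr (sec _ i); rewrite /L -{1}[U](setID _ (A0 :|: A1)).
    by congr (_ :|: _); apply/setIidPr; rewrite subUset A0U.
  rewrite /S !sum_setU //; apply/disjointP => x.
    by rewrite !in_sec; move/disjointP: dA => /(_ (i, x)).
  by rewrite in_setU !in_sec /L in_setD in_setU => ->.
have SL i : S i (sec L i) <= #|T|%:R * (rho * Lam).
  apply: le_trans (sum_link_density_self _ _ _ _ _) _ => //.
  by rewrite ler_wpM2l ?ler0n // ltW.
have SA1 i : S i (sec A1 i) <= rho * #|T|%:R * Lam.
  apply: le_trans (sum_link_density_le _ _ _ _ _) _ => //.
  by rewrite ler_wpM2r // ltW.
have NL : 0 < #|T|%:R * Lam by apply: mulr_gt0.
have i0 : 'I_k := Ordinal (ltnW (ltnW k3)).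
pose phi v := link_density R E L v.1 v.2.
have big : (1 + k%:R * rho) * Lam * #|sec A0 i0|%:R < \sum_(v in A0) phi v.
  rewrite sum_sec; apply: (@le_lt_trans _ _ ((1 + k%:R * rho) * Lam * #|T|%:R)).
    rewrite ler_wpM2l ?ler_nat ?max_card //.
    by rewrite mulr_ge0 // ?krho; [lra | exact: ltW].
  (* Here [k / 2 - 2 * k * rho] is at least 3/2 - 1/6 = 4/3, while [1 + k * rho] is 13/12. *)
  apply: (@lt_le_trans _ _ (\sum_(i < k) (1 / 2 - 2 * rho) * (#|T|%:R * Lam))).
    rewrite sumr_const card_ord -[ltRHS]mulr_natl mulrA mulrBr.
    rewrite (mulrCA k%:R 2) krho -mulrA (mulrC Lam) (ltr_pM2r NL).
    have : 3 <= k%:R :> R by rewrite ler_nat.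
    by lra.
  apply: ler_sum => i _; rewrite -[leRHS]/(S i _).
  have := SU i; rewrite Ssplit; have := SL i; have := SA1 i; lra.
have [A0' [B [tA0' tB dB eqA0 hB]]] := tiled_heavy_tile tA0 big.
have SB i : S i (sec B i) <= M%:R * Lam.
  by apply: le_trans (sum_link_density_le _ _ _ _ _) _; rewrite // tB.1.
have [||i [i' [ii' hi hi']]] := two_heavy _ rho0 SB.
- by rewrite mulr_gt0 // ltr0n.
- move: hB; rewrite sum_sec; congr (_ < _); ring.
have [C [CB cC gC]] := heavy_subset (tB.1 i) M0 rho0 Lam0 M'M hi.
have [C' [CB' cC' gC']] := heavy_subset (tB.1 i') M0 rho0 Lam0 M'M hi'.
have d2le : d2 <= rho * Lam / 4 / (2 ^ M)%:R.
  by rewrite !ler_pM2r ?invr_gt0 ?ltr0n ?expn_gt0 // ler_pM2l.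
have [D [cD DL DE]] := n2P T _ L Tn2 (le_trans d2le gC).
have [D' [cD' DL' DE']] := n2P T _ L Tn2 (le_trans d2le gC').
have BL : [disjoint B & L].
  apply/disjointP => v vB; rewrite !inE => /andP[/norP[]].
  by rewrite eqA0 inE vB orbT.
have [||A [tA AB cA]] := @tile_improve _ _ E M M' B L i i' C C' D D' tB BL ii' M'0 leM'M dvM'M CB CB' cC cC' DL DL' cD cD'.
- by move=> f x fD xC; have /forall_inP := DE f fD; apply.
- by move=> f x fD xC; have /forall_inP := DE' f fD; apply.
have BA0 : B \subset A0 by rewrite eqA0 subsetUr.
have A0'A0 : A0' \subset A0 by rewrite eqA0 subsetUl.
have dA1A : [disjoint A1 & A].
  apply/disjointP => v v1 /(subsetP AB); rewrite inE => /orP[/(subsetP BA0) v0|].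
    by move/disjointP: dA => /(_ v v0 v1).
  by rewrite !inE v1 orbT.
have dA0'A : [disjoint A0' & A].
  apply/disjointP => v v1 /(subsetP AB); rewrite inE => /orP[vB|].
    by move/disjointP: dB => /(_ v v1 vB).
  by rewrite !inE (subsetP A0'A0 _ v1).
exists A0', (A1 :|: A); split=> [|l|l].
- split=> //.
  + exact: subset_trans A0'A0 A0U.
  + rewrite subUset A1U; apply: subset_trans AB _.
    by rewrite subUset LU (subset_trans BA0).
  + apply/disjointP => v v0; rewrite inE => /orP[v1|vA].
      by move/disjointP: dA => /(_ v (subsetP A0'A0 _ v0) v1).
    by move/disjointP: dA0'A => /(_ v v0 vA).
  + exact: tiled_setU.
- by rewrite card_secU // cA eqA0 card_secU // tB.1 (addnCA #|sec A1 l|) !addnA.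
- by rewrite card_secU // cA leq_add2l.
Qed.

End Augmentation.

(** * Bounded iteration of the enlargement *)

Section Iteration.
Variables (R : realType) (k : nat).
Hypothesis k3 : (3 <= k)%N.

(** The gain [gam] per round depends on neither [r] nor [M'], which will bound the number of rounds.
    A round divides the tile size by [N], so the induction on [r] asks the previous rounds for tiles
    of size [N * M']. *)
Lemma almost_tiling_round (eta : R) : 0 < eta ->
  exists2 gam : R, 0 < gam & forall (r M' : nat), (0 < M')%N ->
  exists n0, forall (T : finType) (E : pred {ffun 'I_k -> T}) (U : {set 'I_k * T}) n',
    (n0 <= #|T|)%N -> codegree_into R E U -> (forall i, #|sec U i| = n') ->
    exists A : {set 'I_k * T}, [/\ A \subset U, tiled E M' A &
      (forall i, #|sec (U :\: A) i|%:R <= eta * #|T|%:R) \/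
      (forall i, r%:R * gam * #|T|%:R <= #|sec A i|%:R)].
Proof.
(* These values give [k * rho = 1/12] and [rho * N = 2], as [augment] requires. *)
move=> eta0; pose N := (24 * k)%N; pose rho : R := (12 * k)%:R^-1.
have k0 : (0 < k)%N := ltnW (ltnW k3).
have N0 : (0 < N)%N by rewrite muln_gt0 k0.
have rho0 : 0 < rho by rewrite invr_gt0 ltr0n muln_gt0 k0.
have krho : k%:R * rho = 12^-1.
  by rewrite /rho natrM invfM mulrCA mulfV ?mulr1 // pnatr_eq0 -lt0n.
have Nrho (M' : nat) : 2 * M'%:R <= rho * (N * M')%:R.
  rewrite natrM mulrA /N natrM mulrCA (mulrC rho) krho ler_wpM2r ?ler0n //.
  by lra.
clearbody rho N.
(* An augmentation gains [M'] vertices per part and adds at most [N.+1 * M'] to [A1]; while the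
   total gain is below [gam * #|T|], the parts of [A1] stay below [rho * #|T|]. *)
exists (rho / N.+1%:R); first by rewrite divr_gt0 // ltr0n.
set gam := rho / _; have gamN : N.+1%:R * gam = rho by rewrite mulrC divfK // pnatr_eq0.
clearbody gam.
elim=> [|r IHr] M' M'0.
  exists 0 => T E U n' _ _ _; exists set0; split; [exact: sub0set | left |].
  by right=> i; rewrite !mul0r ler0n.
have M0 : (0 < N * M')%N by rewrite muln_gt0 N0.
have [n1 n1P] := IHr _ M0.
have [n2 n2P] := augment k3 eta0 rho0 krho M'0 M0 (leq_pmull _ N0) (dvdn_mull _ (dvdnn _)) (Nrho M').
exists (maxn n1 n2) => T E U n'; rewrite geq_max => /andP[Tn1 Tn2] codeg cU.
have [A [AU tA [done|large]]] := n1P T E U n' Tn1 codeg cU.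
  by exists A; split=> //; [exact: tiled_refine tA | left].
have [c cA] := tiled_card tA; set a := (c * (N * M'))%N in cA.
set goal := exists A, _.
have scale j : goal \/ exists A0 A1 : {set 'I_k * T}, [/\ two_scale E U (N * M') M' A0 A1,
    forall i, (#|sec A0 i| + #|sec A1 i| = a + j * M')%N &
    forall i, (#|sec A1 i| <= j * (N.+1 * M'))%N].
  elim: j => [|j [|[A0 [A1 [sc cA01 cA1]]]]]; first 1 last.
  - by left.
  - have [A0U A1U dA tA0 tA1] := sc.
    have tA01 : tiled E M' (A0 :|: A1) by apply: tiled_setU => //; apply: tiled_refine tA0.
    have A01U : A0 :|: A1 \subset U by rewrite subUset A0U.
    have cA01' i : #|sec (A0 :|: A1) i| = (a + j * M')%N by rewrite card_secU.
    have [jM|jM] := leP (gam * #|T|%:R) (j * M')%:R.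
      left; exists (A0 :|: A1); split=> //; right=> i.
      rewrite cA01' natrD -natr1 2!mulrDl mul1r; apply: lerD jM.
      by rewrite -(cA i).
    have cL i : #|sec (U :\: (A0 :|: A1)) i| = (n' - (a + j * M'))%N.
      by rewrite card_secD // cU cA01'.
    have [uT|uT] := leP (n' - (a + j * M'))%:R (eta * #|T|%:R).
      by left; exists (A0 :|: A1); split=> //; left=> i; rewrite cL.
    right; have [|A0' [A1' [sc' cA' cA1']]] := n2P T E U A0 A1 _ Tn2 codeg sc cL (ltW uT).
      move=> i; apply: (@le_trans _ _ (j * (N.+1 * M'))%:R); first by rewrite ler_nat.
      by rewrite mulnCA natrM -gamN -mulrA ler_wpM2l ?ler0n // ltW.
    exists A0', A1'; split=> // i; first by rewrite cA' cA01 mulSn; ring.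
    apply: leq_trans (cA1' i) _; have := cA1 i; rewrite !mulSn; clear; lia.
  right; exists A, set0; split=> [|i|i]; last by rewrite sec0 cards0.
    split=> //; [exact: sub0set | by rewrite -setI_eq0 setI0 | left].
  by rewrite sec0 cards0 cA mul0n.
(* [#|T|.+1] augmentations would cover more than [#|T|] vertices of a part. *)
have [//|[A0 [A1 [[_ _ dA _ _] cA01 _]]]] := scale #|T|.+1; exfalso.
pose i0 : 'I_k := Ordinal k0.
have := max_card (mem (sec (A0 :|: A1) i0)); rewrite card_secU // cA01.
clear -M'0; nia.
Qed.

Lemma almost_tiling (eta : R) (M : nat) : 0 < eta -> (0 < M)%N ->
  exists n0, forall (T : finType) (E : pred {ffun 'I_k -> T}) (U : {set 'I_k * T}) n',
    (n0 <= #|T|)%N -> codegree_into R E U -> (forall i, #|sec U i| = n') ->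
    exists A : {set 'I_k * T}, [/\ A \subset U, tiled E M A &
      forall i, #|sec (U :\: A) i|%:R <= eta * #|T|%:R].
Proof.
move=> eta0 M0; have [gam gam0 round] := almost_tiling_round eta0.
(* With [r * gam >= 2], a gain in every round would cover [2 * #|T|] vertices of a part. *)
have [r rP] := archi_large 2 gam0.
have [n0 n0P] := round r M M0; exists n0.+1 => T E U n' Tn0 codeg cU.
have [A [AU tA [small|]]] := n0P T E U n' (ltnW Tn0) codeg cU.
  by exists A.
have i0 : 'I_k := Ordinal (ltnW (ltnW k3)).
move=> /(_ i0) large; exfalso.
have T0 : 1 <= #|T|%:R :> R by rewrite ler1n; apply: leq_trans Tn0.
have leT : #|sec A i0|%:R <= #|T|%:R :> R by rewrite ler_nat max_card.
have := rP r (leqnn r); rewrite mulrC => rgam.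
have := ler_wpM2r (ler0n R #|T|) rgam.
lra.
Qed.

End Iteration.

(** * Absorbers *)

Section Absorbers.
Variables (k m : nat) (T : finType) (E : pred {ffun 'I_k -> T}).
Local Notation J := ('I_m.+1 * 'I_k)%type.
Local Notation V := ('I_k * T)%type.
Implicit Types (w q : {ffun J -> T}) (z : {ffun J * J -> T}) (a b : J).

Definition vset w : {set V} := [set (b.2, w b) | b : J].

Definition part_injective w := forall b b', b.2 = b'.2 -> w b = w b' -> b = b'.

Lemma part_injectiveP w : part_injective w -> injective (fun b => (b.2, w b)).
Proof. by move=> wI b b' []; apply: wI. Qed.

Lemma card_vset w : part_injective w -> #|vset w| = #|{: J}|.
Proof. by move=> /part_injectiveP wI; rewrite card_imset. Qed.

Lemma tile_vset w : part_injective w -> complete E w -> tile E m.+1 (vset w).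
Proof.
move=> wI /forallP wE.
have in_vset i x : (x \in sec (vset w) i) = (x \in [set w (j, i) | j : 'I_m.+1]).
  rewrite in_sec; apply/imsetP/imsetP => [[[j l] _ [-> ->]]|[j _ ->]].
    by exists j.
  by exists (j, i).
split=> [i|f fw].
  rewrite (_ : sec _ i = [set w (j, i) | j : 'I_m.+1]); last exact/setP.
  rewrite card_imset ?card_ord // => j j' /(wI (j, i) (j', i) erefl).
  by case.
have c i : {j | f i = w (j, i)}.
  by apply: sig_eqW; have := fw i; rewrite in_vset => /imsetP[j _ ->]; exists j.
have := wE [ffun i => sval (c i)]; congr (is_true (E _)).
by apply/ffunP => i; rewrite !ffunE; case: (c i).
Qed.

Lemma tiled_array (X : finType) (g : X -> {ffun J -> T}) :
  injective (fun p : X * J => (p.2.2, g p.1 p.2)) -> (forall x, complete E (g x)) ->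
  tiled E m.+1 [set (p.2.2, g p.1 p.2) | p : X * J].
Proof.
move=> gI gE.
have tg x : tile E m.+1 (vset (g x)).
  apply: tile_vset => // b b' bb' gb.
  by have [] : (x, b) = (x, b') by apply: gI; rewrite /= bb' gb.
have -> : [set (p.2.2, g p.1 p.2) | p : X * J] = \bigcup_(x in enum X) vset (g x).
  apply/setP => v; apply/imsetP/bigcupP => [[[x b] _ ->]|[x _ /imsetP[b _ ->]]].
    by exists x; rewrite ?mem_enum //; apply/imsetP; exists b.
  by exists (x, b).
elim: (enum X) (enum_uniq X) => [_|x s IHs /= /andP[xs /IHs ts]].
  by rewrite big_pred0 //; left.
rewrite (bigD1 x) ?mem_head //= setUC.
rewrite (eq_bigl (fun y => y \in s)) => [|y]; last first.
  by rewrite inE andbC; case: eqP => // ->; rewrite (negPf xs).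
apply: TiledU => //; apply/disjointP => v /bigcupP[y ys /imsetP[b _ ->]].
case/imsetP => b' _ yb; have [yx _] : (y, b) = (x, b') by apply: gI.
by rewrite -yx ys in xs.
Qed.

(* An absorber is a [J * J] array whose rows and whose diagonal are complete;
   it absorbs [q] if replacing the diagonal by [q] keeps the rows complete. *)
Definition array_row z a : {ffun J -> T} := [ffun b => z (a, b)].
Definition array_diag z : {ffun J -> T} := [ffun a => z (a, a)].
Definition absorber z := complete E (array_diag z) && [forall a, complete E (array_row z a)].
Definition absorbs z q := [forall a, complete E (upd (array_row z a) a (q a))].
Definition array_vset z : {set V} := [set (p.2.2, z p) | p : J * J].

Lemma tiled_array_vset z : injective z -> absorber z -> tiled E m.+1 (array_vset z).
Proof.
move=> zI /andP[_ /forallP rE].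
have <- : [set (p.2.2, array_row z p.1 p.2) | p : J * J] = array_vset z.
  by apply: eq_imset => -[a b]; rewrite ffunE.
by apply: tiled_array => // -[a b] [a' b'] /= []; rewrite !ffunE => _ /zI.
Qed.

(** The tiles are indexed by [option J]: [None] is the old diagonal, [Some a] the row [a] with [q a]
    in its diagonal place. *)
Lemma tiled_absorbed z q : injective z -> absorber z -> absorbs z q ->
  part_injective q -> [disjoint array_vset z & vset q] ->
  tiled E m.+1 (array_vset z :|: vset q).
Proof.
move=> zI /andP[dE _] /forallP aE qI dq.
pose g (o : option J) := if o is Some a then upd (array_row z a) a (q a) else array_diag z.
pose h (p : option J * J) := (p.2.2, g p.1 p.2).
have sub : array_vset z :|: vset q \subset h @: [set: option J * J].
  rewrite subUset; apply/andP; split; apply/subsetP => v /imsetP[].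
    move=> [a b] _ ->; have [<-|ab] := eqVneq a b.
      by apply/imsetP; exists (None, a); rewrite // /h /= ffunE.
    by apply/imsetP; exists (Some a, b); rewrite // /h /= ffunE eq_sym (negPf ab) ffunE.
  by move=> a _ ->; apply/imsetP; exists (Some a, a); rewrite // /h /= ffunE eqxx.
(* Injectivity of [h] follows by counting: its domain has as many elements as the union that its
   image covers. *)
have card_sp : #|array_vset z :|: vset q| = #|[set: option J * J]|.
  rewrite cardsT card_prod card_option mulSn addnC -card_prod -(card_vset qI).
  rewrite -(card_imset (mem {: J * J}) (_ : injective (fun p => (p.2.2, z p)))); last first.
    by move=> p p' [_ /zI].
  move: dq; rewrite -setI_eq0 => /eqP dq; rewrite cardsU dq cards0 subn0.
  by congr addn; apply: eq_card => v; rewrite !inE.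
have hI : injective h.
  have : #|h @: [set: option J * J]| == #|[set: option J * J]|.
    by rewrite eqn_leq leq_imset_card /= -card_sp subset_leq_card.
  by move/imset_injP => hI p p'; apply: hI; rewrite inE.
have -> : array_vset z :|: vset q = [set h p | p : option J * J].
  apply/eqP; rewrite eqEcard; apply/andP; split.
    by apply: subset_trans sub _; apply/subsetP => v /imsetP[p _ ->]; apply: imset_f.
  by rewrite card_sp cardsT leq_imset_card.
by apply: tiled_array => // -[a|]; [apply: aE | exact: dE].
Qed.

(** * Counting the absorbers of a fixed tuple *)

Section Count.
Variables (R : realType) (eps : R).
Hypothesis k2 : (2 <= k)%N.
Hypothesis eps0 : 0 < eps.
Hypothesis T0 : (0 < #|T|)%N.
Implicit Types (f : {ffun 'I_k -> T}) (P : {ffun J -> T})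
  (y : {ffun option J * J -> T}) (x : T).
Hypothesis codeg : forall f i,
  (2^-1 + eps) * #|T|%:R <= #|[set x | E (upd f i x)]|%:R.

Let N0 : 0 < #|T|%:R :> R. Proof. by rewrite ltr0n. Qed.

Lemma avg_codegree f i : 2^-1 + eps <= avg (fun x => (E (upd f i x))%:R).
Proof.
rewrite (avg_pred R (fun x => E (upd f i x))) ler_pdivlMr //.
by apply: le_trans (codeg f i) _; rewrite cardsE.
Qed.

Lemma edge_density : eps <= avg (fun f => (E f)%:R).
Proof.
have [i0 _] : exists i : 'I_k, true by exists (Ordinal (ltnW k2)).
rewrite (avg_upd T0 i0) -[leLHS](avg_const _ (card_ffun_gt0 T0 'I_k)).
by apply: le_avg => f; apply: le_trans (avg_codegree f i0); lra.
Qed.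

(** [E f] is included because only one of the [m.+1] entries of column [i] is exchanged; selections
    through the others must be edges as they are. *)
Definition exchange i (x x' : T) f := [&& E f, E (upd f i x) & E (upd f i x')].

(* Two codegrees above one half overlap in a proportion [2 * eps]. *)
Lemma exchange_density i x x' : eps <= avg (fun f => (exchange i x x' f)%:R).
Proof.
have [j ji] : exists j : 'I_k, j != i.
  have [i0 | i0] := eqVneq (val i) 0%N.
    by exists (Ordinal k2); apply/eqP => /(congr1 val) /=; rewrite i0.
  by exists (Ordinal (ltnW k2)); apply/eqP => /(congr1 val) /= h; move: i0; rewrite /= -h.
rewrite (avg_upd T0 i).
(* The factor 1/2 pays for [E f]: with the other entries fixed, a random [i]-th entry makes an edge
   with probability above 1/2. The overlap of the other two conditions is found by resampling a
   second part [j]. *)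
apply: (@le_trans _ _ (avg (fun f => 2^-1 * (E (upd f i x) && E (upd f i x'))%:R))); last first.
  apply: le_avg => f; case: (boolP (_ && _)) => [/andP[Ex Ex']|_]; last first.
    by rewrite mulr0 avg_ge0 // => t; rewrite ler0n.
  rewrite mulr1; apply: (@le_trans _ _ (2^-1 + eps)); first by rewrite lerDl ltW.
  apply: le_trans (avg_codegree f i) _; apply: le_avg => t.
  by rewrite /exchange !upd_upd Ex Ex' !andbT.
rewrite avgZl (avg_upd T0 j) ler_pdivlMl //.
rewrite -[leLHS](avg_const _ (card_ffun_gt0 T0 'I_k)); apply: le_avg => f.
apply: (@le_trans _ _ (avg (fun s => (E (upd (upd f i x) j s))%:R +
    (E (upd (upd f i x') j s))%:R - 1 : R))).
  rewrite avgB avgD avg_const //.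
  have := avg_codegree (upd f i x) j; have := avg_codegree (upd f i x') j.
  by lra.
apply: le_avg => s; rewrite !(updC f _ _ ji).
by case: (E _); case: (E _); rewrite /= ?mulr1n ?mulr0n; lra.
Qed.

Definition clone_prob : R := eps ^+ (m.+1 ^ k).

Lemma clone_prob_gt0 : 0 < clone_prob.
Proof. exact: exprn_gt0. Qed.

Lemma complete_upd i j x x' w : complete (exchange i x x') w ->
  complete E (upd w (j, i) x) /\ complete E (upd w (j, i) x').
Proof.
move=> /forallP wE.
suff h t : (forall f, exchange i x x' f -> E (upd f i t)) ->
    complete E (upd w (j, i) t).
  by split; apply: h => f /and3P[].
move=> ht; apply/forallP => c; have := wE c; move: (wE c) => /and3P[Ew _ _].
move=> /ht Ewt; case: (c i =P j) => [ci|/eqP/negPf ci].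
  suff -> : selection (upd w (j, i) t) c = upd (selection w c) i t by [].
  apply/ffunP => l; rewrite !ffunE xpair_eqE; case: (l =P i) => [->|_].
    by rewrite ci eqxx.
  by rewrite andbF.
suff -> : selection (upd w (j, i) t) c = selection w c by [].
apply/ffunP => l; rewrite !ffunE xpair_eqE; case: (l =P i) => [->|_].
  by rewrite ci.
by rewrite andbF.
Qed.

(* The entries [y (None, _)] form the diagonal, the entries [y (Some a, _)] the
   array_row [a], whose diagonal entry is not used. *)
Definition slice (y : {ffun option J * J -> T}) o : {ffun J -> T} := [ffun b => y (o, b)].

(** Once the diagonal is fixed, the rows of [y] are independent; in the absorber itself each row
    shares an entry with the diagonal. *)
Definition pre_absorbs (y : {ffun option J * J -> T}) q :=
  complete E (slice y None) &&
  [forall a, complete (exchange a.2 (y (None, a)) (q a)) (slice y (Some a))].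

Definition absorber_of (y : {ffun option J * J -> T}) : {ffun J * J -> T} :=
  [ffun p => if p.1 == p.2 then y (None, p.1) else y (Some p.1, p.2)].

Lemma absorber_ofP y q : pre_absorbs y q ->
  absorber (absorber_of y) && absorbs (absorber_of y) q.
Proof.
case/andP => dE /forallP rE.
have row_upd a x : upd (array_row (absorber_of y) a) a x = upd (slice y (Some a)) a x.
  by apply/ffunP => b; rewrite !ffunE /= eq_sym; case: eqP.
rewrite -andbA; apply/and3P; split.
- suff -> : array_diag (absorber_of y) = slice y None by [].
  by apply/ffunP => a; rewrite !ffunE /= eqxx.
- apply/forallP => a; rewrite -(upd_id (array_row _ a) a) row_upd !ffunE /= eqxx.
  by have := complete_upd a.1 (rE a); rewrite -surjective_pairing => -[].
- apply/forallP => a; rewrite row_upd.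
  by have := complete_upd a.1 (rE a); rewrite -surjective_pairing => -[].
Qed.

Lemma absorber_of_inj y : injective y -> injective (absorber_of y).
Proof.
move=> yI [a b] [a' b']; rewrite !ffunE /=.
by case: eqP => [->|_]; case: eqP => [->|_] // /yI [] // -> // ->.
Qed.

(** The diagonal is complete with probability at least [clone_prob]; given it, each of the
    [#|{: J}|] rows independently allows its exchange with at least this probability. *)
Lemma pre_absorbs_density q :
  clone_prob ^+ #|{: J}|.+1 <= avg (fun y => (pre_absorbs y q)%:R).
Proof.
rewrite avg_curry.
have cp0 := ltW clone_prob_gt0.
pose good (W : {ffun option J -> {ffun J -> T}}) (P : {ffun J -> T}) (o : option J) : R :=
  if o is Some a then (complete (exchange a.2 (P a) (q a)) (W o))%:R else 1.
have -> : avg (fun W : {ffun option J -> {ffun J -> T}} =>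
      (pre_absorbs [ffun p => W p.1 p.2] q)%:R) =
    avg (fun W : {ffun option J -> {ffun J -> T}} =>
      (complete E (W None))%:R * \prod_o good W (W None) o).
  apply: eq_avg => W.
  have sl o : slice [ffun p => W p.1 p.2] o = W o by apply/ffunP => b; rewrite !ffunE.
  rewrite /pre_absorbs sl; case: (complete E _); rewrite ?mul0r // mul1r.
  case: forallP => [h|].
    rewrite big1 // => -[a|] _ //=; have := h a; rewrite sl ffunE /= => ->.
    by [].
  move=> nh; have [a na] : exists a, ~~ complete (exchange a.2 (W None a) (q a)) (W (Some a)).
    apply/existsP; apply: contra_notT nh => /existsPn h a.
    by have := h a; rewrite negbK sl ffunE.
  by rewrite (bigD1 (Some a)) //= (negPf na) mul0r.
have T0' : (0 < #|{ffun J -> T}|)%N by apply: card_ffun_gt0.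
rewrite (avg_upd T0' None) avgC.
apply: (@le_trans _ _ (avg (fun P => (complete E P)%:R * clone_prob ^+ #|{: J}|))).
  rewrite avgZr exprS; apply: ler_wpM2r; first exact: exprn_ge0.
  exact: (complete_density m T0 (ltW eps0) edge_density).
apply: le_avg => P.
have -> : avg (fun W : {ffun option J -> {ffun J -> T}} =>
    (complete E (upd W None P None))%:R * \prod_o good (upd W None P) (upd W None P None) o) =
    (complete E P)%:R * avg (fun W => \prod_o good W P o).
  rewrite -avgZl; apply: eq_avg => W; rewrite upd_same; congr (_ * _).
  by apply: eq_bigr => -[a|] _ //=; rewrite upd_other.
rewrite ler_wpM2l ?ler0n //.
pose g (o : option J) (w : {ffun J -> T}) : R :=
  if o is Some a then (complete (exchange a.2 (P a) (q a)) w)%:R else 1.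
have -> : avg (fun W => \prod_o good W P o) = \prod_o avg (g o).
  by rewrite -avg_prod; apply: eq_avg => W; apply: eq_bigr => -[].
rewrite (bigD1 None) //= avg_const // mul1r.
apply: (@le_trans _ _ (\prod_(o : option J | o != None) clone_prob)).
  by rewrite prodr_const cardC1 card_option.
apply: ler_prod => -[a|] // _; rewrite cp0 /=.
exact: (complete_density m T0 (ltW eps0) (exchange_density _ _ _)).
Qed.

End Count.
End Absorbers.

(** * The absorbing family *)

(** With [c = 2 K (d + 1)] and [z] the integer part of [n / c], a large [n] is less than
    [(z + 1) ^ 2], and [z + 1 <= 2 ^ z]. *)
Lemma expn_lt_exp2 (d K : nat) : (0 < K)%N ->
  exists n0, forall n, (n0 <= n)%N -> (n ^ d < 2 ^ (n %/ K))%N.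
Proof.
move=> K0; pose e := (2 * d.+1)%N; pose c := (K * e)%N.
have c0 : (0 < c)%N by rewrite muln_gt0 K0.
exists (c * c)%N => n cn; pose z := (n %/ c)%N.
have cz : (c <= z)%N by rewrite leq_divRL.
have nz : (n < z.+1 ^ 2)%N.
  apply: (@leq_trans (z.+1 * c)); first exact: ltn_ceil.
  by rewrite expnS expn1 leq_mul2l ltnW.
apply: (@leq_ltn_trans (n ^ d.+1)).
  by rewrite leq_pexp2l // (leq_trans _ cn) // muln_gt0 c0.
apply: (@leq_trans ((z.+1 ^ 2) ^ d.+1)); first by rewrite ltn_exp2r.
apply: (@leq_trans (2 ^ (z * e))); last first.
  by rewrite leq_exp2l // /z /c divnMA leq_trunc_div.
by rewrite -expnM -/e expnM leq_exp2r ?muln_gt0 // ltn_expl.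
Qed.

(** Bernoulli's inequality gives [(1 + x) ^+ c >= 4] for large [c], while
    [(1 - x) * (1 + x) <= 1]. *)
Lemma expr_small (R : realType) (x : R) : 0 < x -> x <= 1 ->
  exists c : nat, (1 - x) ^+ c <= 4^-1.
Proof.
move=> x0 x1; have [n nP] := archi_large 3 x0; exists n.+1.
have bern : 4 <= (1 + x) ^+ n.+1.
  have x1' : 0 <= 1 + x by lra.
  have := pow_tangent n ler01 x1'; rewrite !expr1n.
  have := nP n.+1 (leqnSn n); rewrite mulr1; move: (n.+1%:R) => t; nra.
have prod1 : (1 - x) ^+ n.+1 * (1 + x) ^+ n.+1 <= 1.
  by rewrite -exprMn exprn_ile1 //; nra.
have : 0 <= (1 - x) ^+ n.+1 by rewrite exprn_ge0 //; lra.
nra.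
Qed.

Section AbsorbingFamily.
Variables (R : realType) (k m : nat) (eps : R).
Local Notation J := ('I_m.+1 * 'I_k)%type.
Local Notation Jo := (option J * J)%type.
Hypothesis k2 : (2 <= k)%N.
Hypothesis eps0 : 0 < eps.

Let beta : R := clone_prob k m eps ^+ #|{: J}|.+1.

Section Fixed.
Variables (T : finType) (E : pred {ffun 'I_k -> T}).
Hypothesis T0 : (0 < #|T|)%N.
Hypothesis codeg : forall (f : {ffun 'I_k -> T}) i,
  (2^-1 + eps) * #|T|%:R <= #|[set x | E (upd f i x)]|%:R.
Implicit Types (q : {ffun J -> T}) (z : {ffun J * J -> T}) (D : {set T}).
Implicit Type Z : {set {ffun J * J -> T}}.

(** A random array absorbs an expected share of at least [beta] of the weight; discarding arrays
    with a repetition or an entry in [D] costs at most [beta / 2], and some array does as well as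
    the average. *)
Lemma pick_absorber (D : {set T}) (wt : {ffun J -> T} -> R) :
  (#|{: Jo}| * #|{: Jo}| + #|{: Jo}| * #|D|)%:R / #|T|%:R <= beta / 2 ->
  (forall q, 0 <= wt q) -> 0 < \sum_q wt q -> exists z,
  [/\ injective z, absorber E z, forall p, z p \notin D &
      beta / 2 * \sum_q wt q <= \sum_q wt q * (absorbs E z q)%:R].
Proof.
move=> conflict wt0 Wt0.
pose ok (y : {ffun Jo -> T}) := injectiveb y && [forall p, y p \notin D].
pose hit (y : {ffun Jo -> T}) q := pre_absorbs E y q && ok y.
have beta0 : 0 < beta by apply/exprn_gt0/clone_prob_gt0.
have : beta / 2 * \sum_q wt q <= avg (fun y => \sum_q wt q * (hit y q)%:R).
  rewrite avg_sum mulr_sumr; apply: ler_sum => q _; rewrite avgZl mulrC.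
  apply: ler_wpM2l => //.
  apply: (@le_trans _ _ (avg (fun y => (pre_absorbs E y q)%:R + (ok y)%:R - 1 : R))).
    rewrite avgB avgD avg_const ?card_ffun_gt0 //.
    have := avg_avoid R T0 Jo D; have := pre_absorbs_density k2 eps0 T0 codeg q.
    by rewrite -/beta -/(ok _); lra.
  apply: le_avg => y; rewrite /hit.
  by case: (pre_absorbs _ _ _); case: (ok y); rewrite /= ?mulr1n ?mulr0n; lra.
case/avg_ex => [|y hy]; first exact: card_ffun_gt0.
(* As the weight is positive, the array hits some [q], which certifies that it is injective, avoids
   [D] and yields an absorber. *)
have [q hq] : exists q, hit y q.
  apply/existsP; apply: contraLR hy => /existsPn no; rewrite -ltNge big1.
    by rewrite !mulr_gt0 // invr_gt0.
  by move=> q _; rewrite (negPf (no q)) mulr0.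
have /andP[pre_y /andP[/injectiveP yI /forallP yD]] := hq.
have /andP[abs_y _] := absorber_ofP pre_y.
exists (absorber_of y); split=> //; first exact: absorber_of_inj.
  by move=> p; rewrite ffunE; case: ifP.
apply: le_trans hy _; apply: ler_sum => q' _; apply: ler_wpM2l => //.
rewrite ler_nat; case: (boolP (hit y q')) => // /andP[/absorber_ofP/andP[_ ->]].
by [].
Qed.

Definition disjoint_family Z :=
  (forall z, z \in Z -> injective z /\ absorber E z) /\
  (forall z z' p p', z \in Z -> z' \in Z -> z p = z' p' -> z = z').

(** Elements are collected regardless of their part, so one set bounds what the absorbers occupy in
    every part. *)
Definition used Z : {set T} := \bigcup_(z in Z) [set z p | p : J * J].

Definition hits Z q := #|[set z in Z | absorbs E z q]|.

Lemma card_used Z : (#|used Z| <= #|Z| * #|{: J * J}|)%N.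
Proof.
rewrite /used -sum_nat_const.
elim/big_ind2: _ => [|A a B b Aa Bb|z _]; [by rewrite cards0 | | exact: leq_imset_card].
exact: leq_trans (leq_card_setU _ _) (leq_add Aa Bb).
Qed.

(* Multiplicative weights: each new absorber is chosen to absorb a [beta / 2]
   fraction of the total weight, and the weight of an absorbed [q] is halved. *)
Lemma weighted_family t : beta <= 1 ->
  (#|{: Jo}| * #|{: Jo}| + #|{: Jo}| * (t * #|{: J * J}|))%:R / #|T|%:R <= beta / 2 ->
  exists Z, [/\ disjoint_family Z, #|Z| = t &
    \sum_q 2^-1 ^+ hits Z q <= (1 - beta / 4) ^+ t * #|{: {ffun J -> T}}|%:R].
Proof.
move=> beta1; elim: t => [|t IHt] small.
  exists set0; split; first by split=> [z|z z' p p']; rewrite inE.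
    by rewrite cards0.
  rewrite expr0 mul1r -sum1_card natr_sum; apply: ler_sum => q _.
  by rewrite exprn_ile1 //; lra.
have T1 : 0 < #|T|%:R^-1 :> R by rewrite invr_gt0 ltr0n.
have {IHt}[|Z [[ZI ZD] cZ sumZ]] := IHt.
  apply: le_trans small; rewrite ler_pM2r // ler_nat leq_add2l leq_mul2l.
  by rewrite leq_mul2r leqnSn !orbT.
pose wt q : R := 2^-1 ^+ hits Z q.
have wt0 q : 0 < wt q by rewrite exprn_gt0 // invr_gt0.
have /card_gt0P[q0 _] := card_ffun_gt0 T0 J.
have [|q||z [zI zA zD hz]] := @pick_absorber (used Z) wt.
- apply: le_trans small; rewrite ler_pM2r // ler_nat leq_add2l leq_mul2l.
  by rewrite (leq_trans (card_used Z)) ?orbT // cZ leq_mul2r leqnSn orbT.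
- exact: ltW.
- by rewrite (bigD1 q0) //= ltr_wpDr // sumr_ge0 // => q _; apply: ltW.
have zZ z' p p' : z' \in Z -> z p = z' p' -> False.
  move=> z'Z zz'; have /negP := zD p; apply; rewrite zz'.
  by apply/bigcupP; exists z' => //; apply: imset_f.
have p0 : J * J by do 2!split; (exact: ord0 || exact: (Ordinal (ltnW k2))).
have znZ : z \notin Z by apply/negP => zinZ; apply: (zZ z p0 p0).
exists (z |: Z); split.
- split=> [z'|z1 z2 p1 p2]; first by rewrite in_setU1 => /orP[/eqP->|/ZI].
  rewrite !in_setU1 => /orP[/eqP->|z1Z] /orP[/eqP->|z2Z] // e12.
  + by have := zZ _ _ _ z2Z e12.
  + by have := zZ _ _ _ z1Z (esym e12).
  + exact: ZD e12.
- by rewrite cardsU1 znZ cZ.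
have hitsZ q : hits (z |: Z) q = (absorbs E z q + hits Z q)%N.
  rewrite /hits; case: (boolP (absorbs E z q)) => zq.
    rewrite (_ : [set _ in _ | _] = z |: [set z in Z | absorbs E z q]).
      by rewrite cardsU1 inE (negPf znZ).
    by apply/setP => z'; rewrite !inE; case: eqP => [->|].
  rewrite add0n; apply: eq_card => z'; rewrite !inE; case: eqP => [->|] //=.
  by rewrite (negPf zq) andbF.
(* Half of the absorbed weight, itself at least [beta / 2] of the total, disappears; this gives the
   factor [1 - beta / 4]. *)
have -> : \sum_q 2^-1 ^+ hits (z |: Z) q =
    \sum_q wt q - 2^-1 * \sum_q wt q * (absorbs E z q)%:R.
  rewrite mulr_sumr -sumrB; apply: eq_bigr => q _; rewrite hitsZ exprD -/(wt q).
  by case: (absorbs E z q); rewrite ?expr0 ?expr1 /= ?mulr1n; lra.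
rewrite exprS -mulrA; apply: (@le_trans _ _ ((1 - beta / 4) * \sum_q wt q)).
  by lra.
by apply: ler_wpM2l; [lra | exact: sumZ].
Qed.

(** A [q] with fewer than [r] absorbers would alone weigh at least 1 over [2 ^ r]; but there are
    fewer than [2 ^ r] functions, and the decay by [4 ^ r] leaves less than that in total. *)
Lemma family_hits c r : beta <= 1 -> (1 - beta / 4) ^+ c <= 4^-1 ->
  (#|{: {ffun J -> T}}| < 2 ^ r)%N ->
  (#|{: Jo}| * #|{: Jo}| + #|{: Jo}| * (c * r * #|{: J * J}|))%:R / #|T|%:R <= beta / 2 ->
  exists Z, [/\ disjoint_family Z, #|Z| = (c * r)%N & forall q, (r <= hits Z q)%N].
Proof.
move=> beta1 c4 Qr small; have [Z [fZ cZ sumZ]] := weighted_family beta1 small.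
exists Z; split=> // q; rewrite leqNgt; apply/negP => hr.
have h2 : 0 < 2^-1 :> R by rewrite invr_gt0.
have : 2^-1 ^+ r <= (1 - beta / 4) ^+ (c * r) * #|{: {ffun J -> T}}|%:R.
  apply: le_trans sumZ; rewrite (bigD1 q) //=; apply: ler_wpDr.
    by rewrite sumr_ge0 // => q' _; rewrite exprn_ge0 ?ltW.
  by rewrite ler_wiXn2l //; [exact: ltW | lra | exact: ltnW].
apply/negP; rewrite -ltNge.
apply: (@le_lt_trans _ _ (4^-1 ^+ r * #|{: {ffun J -> T}}|%:R)).
  apply: ler_wpM2r; rewrite ?ler0n // exprM; apply: lerXn2r => //.
    by rewrite nnegrE exprn_ge0 //; lra.
  by rewrite nnegrE invr_ge0.
apply: (@lt_le_trans _ _ (4^-1 ^+ r * (2 ^ r)%:R)).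
  by rewrite ltr_pM2l ?ltr_nat // exprn_gt0 // invr_gt0.
by rewrite natrX -exprMn (_ : 4^-1 * 2 = 2^-1 :> R) //; lra.
Qed.

End Fixed.
End AbsorbingFamily.

Lemma absorbing_family (R : realType) (k m : nat) (eps : R) :
  (2 <= k)%N -> 0 < eps -> eps <= 1 ->
  exists2 eta : R, 0 < eta & exists n0, forall (T : finType) (E : pred {ffun 'I_k -> T}),
    (n0 <= #|T|)%N ->
    (forall (f : {ffun 'I_k -> T}) i,
       (2^-1 + eps) * #|T|%:R <= #|[set x | E (upd f i x)]|%:R) ->
    exists Z : {set {ffun ('I_m.+1 * 'I_k) * ('I_m.+1 * 'I_k) -> T}},
      [/\ disjoint_family E Z, #|used Z|%:R <= eps * #|T|%:R &
          forall q, eta * #|T|%:R <= (hits E Z q)%:R].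
Proof.
move=> k2 eps0 eps1.
set J := ('I_m.+1 * 'I_k)%type.
set beta := clone_prob k m eps ^+ #|{: J}|.+1.
have beta0 : 0 < beta by apply/exprn_gt0/clone_prob_gt0.
have beta1 : beta <= 1.
  by rewrite exprn_ile1 ?exprn_ge0 ?exprn_ile1 // ltW.
have beta4 : 0 < beta / 4 by rewrite divr_gt0.
have [|c c4] := expr_small beta4; first by lra.
pose P := #|{: J * J}|; pose Q := #|{: option J * J}|.
have [n1 n1P] := archi_large (c * P)%:R eps0.
have [n2 n2P] := archi_large (Q * (c * P))%:R beta4.
have [n3 n3P] := archi_large (Q * Q)%:R beta4.
(* The family has [c * r] members, [r] being the integer part of [#|T| / K]. [K] is so large that
   they occupy at most [eps * #|T|] elements and that avoiding them costs at most [beta / 4];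
   another [beta / 4] covers repetitions within one array. *)
pose K := maxn 1 (maxn n1 n2).
have K0 : (0 < K)%N by rewrite leq_maxl.
have K1 : (c * P)%:R <= eps * K%:R by apply: n1P; rewrite /K !leq_max leqnn !orbT.
have K2 : (Q * (c * P))%:R <= beta / 4 * K%:R by apply: n2P; rewrite /K !leq_max leqnn !orbT.
clearbody K.
have [n4 n4P] := expn_lt_exp2 #|{: J}| K0.
(* As [r >= 1], rounding down loses at most a factor 2: [#|T| <= 2 * r * K]. *)
exists (2 * K)%:R^-1; first by rewrite invr_gt0 ltr0n muln_gt0.
exists (maxn K (maxn n3 n4)) => T E; rewrite !geq_max => /and3P[TK T3 T4] codeg.
have T0 : (0 < #|T|)%N by exact: (leq_trans K0 TK).
set r := (#|T| %/ K)%N.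
have r0 : (0 < r)%N by rewrite divn_gt0.
have rK : (r * K <= #|T|)%N by apply: leq_trunc_div.
have scaleT (a : nat) (b : R) : 0 <= b -> a%:R <= b * K%:R -> (r * a)%:R <= b * #|T|%:R.
  move=> b0 ab; apply: (@le_trans _ _ (b * (r * K)%:R)).
    by rewrite !natrM mulrCA ler_wpM2l ?ler0n.
  by rewrite ler_wpM2l // ler_nat.
have [||Z [fZ cZ hZ]] := @family_hits R k m eps k2 eps0 T E T0 codeg c r beta1 c4.
- by rewrite card_ffun; apply: n4P.
- rewrite -/J -/Q -/P ler_pdivrMr ?ltr0n // natrD.
  have := n3P _ T3; have := scaleT _ _ (ltW beta4) K2.
  by rewrite -/beta (_ : r * (Q * (c * P)) = Q * (c * r * P))%N; [lra | ring].
exists Z; split=> // [|q].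
  apply: le_trans (scaleT _ _ (ltW eps0) K1).
  by rewrite ler_nat (leq_trans (card_used Z)) // cZ -/P mulnA (mulnC r).
rewrite mulrC ler_pdivrMr ?ltr0n ?muln_gt0 // -natrM ler_nat.
apply: (@leq_trans (r * (2 * K))); last by rewrite leq_mul2r hZ orbT.
apply: leq_trans (ltnW (ltn_ceil #|T| K0)) _; rewrite -/r mulnA leq_mul2r; apply/orP; right.
by rewrite muln2 -addnn -addn1 leq_add2l.
Qed.

(** * Assembly *)

Section Assembly.
Variables (k m : nat) (T : finType) (E : pred {ffun 'I_k -> T}).
Local Notation J := ('I_m.+1 * 'I_k)%type.
Local Notation V := ('I_k * T)%type.
Implicit Type (Z : {set {ffun J * J -> T}}) (L : {set V}).

Definition family_vset Z : {set V} := \bigcup_(z in Z) array_vset z.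

Lemma family_vsetD1 Z z : z \in Z -> family_vset Z = array_vset z :|: family_vset (Z :\ z).
Proof. by move=> zZ; rewrite /family_vset (big_setD1 z). Qed.

Lemma disjoint_familyD1 Z z : disjoint_family E Z -> z \in Z ->
  disjoint_family E (Z :\ z) /\ [disjoint array_vset z & family_vset (Z :\ z)].
Proof.
move=> [ZI ZD] zZ; split.
  by split=> [z' /setD1P[_ /ZI]//|z1 z2 p1 p2 /setD1P[_ ?] /setD1P[_ ?]]; apply: ZD.
apply/disjointP => v /imsetP[p _ ->] /bigcupP[z' /setD1P[z'z z'Z]].
case/imsetP => p' _ [_ /ZD zz']; have := zz' zZ z'Z => e.
by rewrite e eqxx in z'z.
Qed.

Lemma tiled_family_vset Z : disjoint_family E Z -> tiled E m.+1 (family_vset Z).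
Proof.
elim: {Z}#|Z| {-2}Z (erefl #|Z|) => [|n IHn] Z cZ fZ.
  by rewrite /family_vset (cards0_eq cZ) big_set0; left.
have /card_gt0P[z zZ] : (0 < #|Z|)%N by rewrite cZ.
have [fZ' dz] := disjoint_familyD1 fZ zZ; have [zI zA] := fZ.1 z zZ.
rewrite (family_vsetD1 zZ); apply: tiled_setU => //; first exact: tiled_array_vset.
by apply: IHn => //; move: cZ; rewrite (cardsD1 z) zZ => -[].
Qed.

Lemma enumerate_fam (D : 'I_k -> {set T}) n : (forall i, #|D i| = n) ->
  exists f : 'I_k -> 'I_n -> T,
    [/\ forall i, injective (f i), forall i j, f i j \in D i &
        forall i x, x \in D i -> exists j, f i j = x].
Proof.
move=> cD; exists (fun i j => enum_val (cast_ord (esym (cD i)) j)); split.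
- by move=> i j j' /enum_val_inj /cast_ord_inj.
- by move=> i j; apply: enum_valP.
move=> i x xD; exists (cast_ord (cD i) (enum_rank_in xD x)).
by rewrite cast_ordK enum_rankK_in.
Qed.

(** Each step gives a piece of [L] with [m.+1] vertices in each part to one of its absorbers and
    discards that absorber, which lowers every count [hits] by at most one. *)
Lemma absorb_leftover r Z L : disjoint_family E Z ->
  [disjoint family_vset Z & L] -> (forall i, #|sec L i| = (r * m.+1)%N) ->
  (forall q, (r <= hits E Z q)%N) -> tiled E m.+1 (family_vset Z :|: L).
Proof.
elim: r Z L => [|r IHr] Z L fZ dL cL hZ.
  rewrite (_ : L = set0) ?setU0; first exact: tiled_family_vset.
  apply/setP => -[i x]; rewrite -in_sec in_set0.
  by have /cards0_eq -> := cL i; rewrite inE.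
have [|D DP] := @exists_subfam T k (sec L) m.+1.
  by move=> i; rewrite cL mulSn leq_addr.
have [f [fI fD Df]] := enumerate_fam (fun i => (DP i).2).
pose q : {ffun J -> T} := [ffun b => f b.2 b.1].
have qI : part_injective q.
  by move=> [j i] [j' i'] /= <-; rewrite !ffunE /= => /fI ->.
have qD : vset q = fam D.
  apply/setP => -[i x]; rewrite inE; apply/imsetP/idP => [[[j l] _ [-> ->]]|xD].
    by rewrite ffunE fD.
  by have [j <-] := Df i x xD; exists (j, i); rewrite // ffunE.
have DL : fam D \subset L by apply: fam_sub => i; case: (DP i).
have [z] : exists z, z \in [set z in Z | absorbs E z q].
  by apply/card_gt0P; apply: leq_trans (hZ q).
rewrite inE => /andP[zZ zq].
have [fZ' dz] := disjoint_familyD1 fZ zZ; have [zI zA] := fZ.1 z zZ.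
move/disjointP: dL => dL; have dL' := dL; rewrite (family_vsetD1 zZ) in dL'.
have -> : family_vset Z :|: L =
    (family_vset (Z :\ z) :|: (L :\: fam D)) :|: (array_vset z :|: vset q).
  apply/setP => v; rewrite (family_vsetD1 zZ) qD !in_setU in_setD.
  have := subsetP DL v; case: (v \in array_vset z); case: (v \in family_vset _);
  by case: (v \in fam D); case: (v \in L) => //= h; have := h isT.
apply: tiled_setU.
- apply: IHr => //.
  + by apply/disjointP => v vZ /setDP[vL _]; apply: (dL' v) => //; rewrite inE vZ orbT.
  + by move=> i; rewrite card_secD // cL sec_fam (DP i).2 mulSn addKn.
  move=> q'; rewrite -ltnS (leq_trans (hZ q')) // /hits (cardsD1 z).
  rewrite -[X in (_ <= X)%N]add1n; apply: leq_add; first exact: leq_b1.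
  by apply/subset_leq_card/subsetP => z'; rewrite !inE => /and3P[-> -> ->].
- apply: tiled_absorbed => //; rewrite qD; apply/disjointP => v vz /(subsetP DL).
  by apply: dL'; rewrite inE vz.
apply/disjointP => v; rewrite qD !in_setU in_setD => /orP[vZ|/andP[vD vL]].
  case/orP=> [vz|/(subsetP DL)]; first by move/disjointP: dz => /(_ v vz vZ).
  by apply: dL'; rewrite inE vZ orbT.
rewrite (negPf vD) orbF => vz; by apply: (dL' v) => //; rewrite inE vz.
Qed.

Lemma sec_family_vset Z i : sec (family_vset Z) i \subset used Z.
Proof.
apply/subsetP => x; rewrite in_sec => /bigcupP[z zZ /imsetP[p _ [_ ->]]].
by apply/bigcupP; exists z => //; apply: imset_f.
Qed.

End Assembly.

Lemma complete_factor (R : realType) (k m : nat) (eps : R) : (3 <= k)%N -> 0 < eps ->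
  exists n0, forall (T : finType) (E : pred {ffun 'I_k -> T}),
    (n0 <= #|T|)%N -> (m.+1 %| #|T|)%N ->
    (forall (f : {ffun 'I_k -> T}) i,
       (2^-1 + eps) * #|T|%:R <= #|[set x | E (upd f i x)]|%:R) ->
    tiled E m.+1 setT.
Proof.
move=> k3 eps0; have k2 := ltnW k3.
pose e := Num.min eps 1.
have e0 : 0 < e by rewrite lt_min eps0 ltr01.
have e1 : e <= 1 by rewrite ge_min lexx orbT.
have ee : e <= eps by rewrite ge_min lexx.
have [eta eta0 [n1 n1P]] := absorbing_family m k2 e0 e1.
have [n2 n2P] := almost_tiling k3 eta0 (ltn0Sn m).
exists (maxn n1 n2) => T E; rewrite geq_max => /andP[Tn1 Tn2] dvdT codeg.
have codeg' (f : {ffun 'I_k -> T}) i :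
    (2^-1 + e) * #|T|%:R <= #|[set x | E (upd f i x)]|%:R.
  by apply: le_trans (codeg f i); rewrite ler_wpM2r ?ler0n // lerD2l.
have [Z [fZ uZ hZ]] := n1P T E Tn1 codeg'.
set A := family_vset Z; have tA : tiled E m.+1 A by apply: tiled_family_vset.
have [c cA] := tiled_card tA.
have cU i : #|sec (~: A) i| = (#|T| - c * m.+1)%N.
  by rewrite -setTD card_secD ?subsetT // secT cardsT cA.
have codegU : codegree_into R E (~: A).
  move=> f i; set X := [set x in _ | _].
  have le : (#|[set x | E (upd f i x)]| <= #|X| + #|used Z|)%N.
    apply: leq_trans (leq_card_setU _ _); apply/subset_leq_card/subsetP => x.
    rewrite in_set => Ex; rewrite in_setU /X in_set Ex andbT in_sec in_setC.
    case: (boolP ((i, x) \in A)) => //= xA.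
    by apply: (subsetP (sec_family_vset Z i)); rewrite in_sec.
  have := codeg' f i; move: le; rewrite -(ler_nat R) natrD; move: uZ.
  clear; lra.
have [B [BU tB small]] := n2P T E (~: A) _ Tn2 codegU cU.
have [b cB] := tiled_card tB; set L := ~: A :\: B in small.
(* The absorbers and [B] are tiled, so the divisibility of [#|T|] passes to the leftover. *)
have cL i : #|sec L i| = ((#|T| %/ m.+1 - c - b) * m.+1)%N.
  by rewrite /L card_secD // cU cB !mulnBl divnK.
have dAB : [disjoint A :|: L & B].
  apply/disjointP => v; rewrite /L !inE => /orP[vA /(subsetP BU)|/andP[/negP]] //.
  by rewrite inE vA.
rewrite (_ : setT = (A :|: L) :|: B); last first.
  apply/setP => v; rewrite /L !inE; case: (v \in A) => //=; by case: (v \in B).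
apply: tiled_setU => //; apply: (absorb_leftover fZ _ cL) => //.
  by apply/disjointP => v vA; rewrite /L !inE vA andbF.
move=> q; rewrite -(ler_nat R); apply: le_trans (hZ q).
have i0 : 'I_k := Ordinal (ltnW k2).
apply: le_trans (small i0); rewrite cL ler_nat leq_pmulr //.
Qed.

(** * Translation to k-partite hypergraphs *)

Lemma legal_eq k n (S : {set kvert k n}) v v' : legal S -> v \in S -> v' \in S ->
  v.1 = v'.1 -> v = v'.
Proof.
move=> lS vS v'S vv'; apply/eqP; rewrite -[_ == _]negbK; apply/negP => ne.
have := lS v.1; apply/negP; rewrite -ltnNge.
suff sub : [set v; v'] \subset [set u in S | u.1 == v.1].
  by apply: leq_trans (subset_leq_card sub); rewrite cards2 ne.
by apply/subsetP => u; rewrite !inE => /orP[]/eqP->; rewrite ?vS ?v'S ?vv' eqxx.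
Qed.

(** An edge has [k] vertices in distinct parts, hence exactly one in each. *)
Lemma edge_selection k m (F : {set {set kvert k m}}) e : kpartite_kgraph F -> e \in F ->
  exists c : 'I_k -> 'I_m, e = [set (i, c i) | i : 'I_k].
Proof.
move=> Fk eF; have [ce le] := Fk e eF.
have inj : {in e &, injective (fun v : kvert k m => v.1)}.
  by move=> v v' ve v'e; apply: legal_eq le ve v'e.
have c i : {j | (i, j) \in e}.
  apply: sigW.
  suff : i \in [set v.1 | v in e] by case/imsetP=> -[i' j] ve ->; exists j.
  suff -> : [set v.1 | v in e] = setT by rewrite inE.
  by apply/eqP; rewrite eqEcard subsetT cardsT card_ord card_in_imset // ce /=.
exists (fun i => sval (c i)); apply/esym/eqP; rewrite eqEcard; apply/andP; split.
  by apply/subsetP => _ /imsetP[i _ ->]; case: (c i).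
by rewrite ce card_imset ?card_ord // => i i' [].
Qed.

Section Translation.
Variables (k n : nat) (H : {set {set kvert k n}}).
Hypothesis Hk : kpartite_kgraph H.
Implicit Type f : {ffun 'I_k -> 'I_n}.

Definition edge_of f : {set kvert k n} := [set (i, f i) | i : 'I_k].

Definition is_edge f := edge_of f \in H.

(** [S] is [edge_of f] without its vertex in part [i]. A set counted by its degree is a single
    vertex, which legality forces into part [i]. *)
Lemma deg_le f i : exists S : {set kvert k n}, [/\ legal S, #|S| = k.-1 &
  (deg H S <= #|[set x | is_edge (upd f i x)]|)%N].
Proof.
pose S := [set (l, f l) | l in [set~ i]].
have inS v : v \in S -> v = (v.1, f v.1) /\ v.1 != i.
  by case/imsetP => l; rewrite !inE => li ->.
have cS : #|S| = k.-1.
  by rewrite card_imset ?cardsC1 ?card_ord // => l l' [].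
have lS : legal S.
  move=> l; suff sub : [set v in S | v.1 == l] \subset [set (l, f l)].
    by apply: leq_trans (subset_leq_card sub) _; rewrite cards1.
  by apply/subsetP => v; rewrite !inE => /andP[/inS[-> _]] /= /eqP ->.
exists S; split=> //; rewrite /deg cS.
have k0 : (0 < k)%N by apply: leq_ltn_trans (ltn_ord i).
have -> : (k - k.-1 = 1)%N by rewrite -{1}(prednK k0) subSnn.
apply: (@leq_trans #|[set [set ((i, x) : kvert k n)] | x in [set x | is_edge (upd f i x)]]|);
  last exact: leq_imset_card.
apply/subset_leq_card/subsetP => S'; rewrite inE => /andP[/cards1P[v ->]] SvH.
have [cSv lSv] := Hk SvH.
have vSv : v \in S :|: [set v] by rewrite !inE eqxx orbT.
have vS : v \notin S.
  apply/negP => vS; move: cSv; rewrite (setUidPl _) ?sub1set // cS => /eqP.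
  by rewrite -{2}(prednK k0) ltn_eqF.
have vi : v.1 = i.
  apply/eqP; rewrite -[_ == _]negbK; apply/negP => vi.
  have fS : (v.1, f v.1) \in S by apply/imsetP; exists v.1; rewrite // !inE.
  have := legal_eq lSv vSv (_ : (v.1, f v.1) \in _) erefl.
  by rewrite inE fS => /(_ isT) vE; rewrite vE fS in vS.
apply/imsetP; exists v.2; last by rewrite -vi -surjective_pairing.
rewrite inE /is_edge (_ : edge_of _ = S :|: [set v]) //.
apply/setP => u; rewrite inE in_set1; apply/imsetP/orP => [[l _ ->]|[uS|/eqP ->]].
- rewrite ffunE; have [->|li] := eqVneq l i.
    by right; rewrite -vi -surjective_pairing.
  by left; apply/imsetP; exists l; rewrite // !inE.
- by have [uE ui] := inS _ uS; exists u.1; rewrite // upd_other.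
by exists i; rewrite // upd_same -vi -surjective_pairing.
Qed.

Section Copies.
Variables (m : nat) (F : {set {set kvert k m}}).
Hypothesis Fk : kpartite_kgraph F.

(** Any bijections between corresponding parts embed [F], since every transversal of [B] is an
    edge. *)
Lemma tile_copy (B : {set kvert k n}) : tile is_edge m B ->
  exists phi, [/\ is_copy F H phi, forall u, phi u \in B &
    forall v, v \in B -> exists u, phi u = v].
Proof.
move=> [cB BE]; have [f [fI fB Bf]] := enumerate_fam cB.
exists (fun u : kvert k m => (u.1, f u.1 u.2)); split=> [|[i j]|[i x]] /=.
- split=> [[i j] [i' j'] /= [<- /fI ->]//|e eF].
  have [c ->] := edge_selection Fk eF; rewrite -imset_comp.
  have := BE [ffun i => f i (c i)]; rewrite /is_edge /edge_of => /(_ _).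
  rewrite (eq_imset _ (_ : _ =1 (fun i => (i, f i (c i))))); last by move=> i; rewrite ffunE.
  by apply=> i; rewrite ffunE.
- by have := fB i j; rewrite in_sec.
by rewrite -in_sec => /Bf[j <-]; exists (i, j).
Qed.

Lemma tiled_copies (A : {set kvert k n}) : tiled is_edge m A ->
  exists (X : finType) (phi : X -> kvert k m -> kvert k n),
    [/\ forall x, is_copy F H (phi x), forall x u, phi x u \in A,
        forall v, v \in A -> exists x u, phi x u = v &
        forall x x' u u', phi x u = phi x' u' -> x = x'].
Proof.
elim=> [|{}A B _ [X [phi [pc pA Ap pI]]] tB /disjointP dAB].
  by exists void, (of_void _); split=> [[]|[]|v|[]] //; rewrite inE.
have [psi [sc sB Bs]] := tile_copy tB.
exists (option X), (fun o => if o is Some x then phi x else psi); split.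
- by case.
- by case=> [x|] u; rewrite inE ?pA ?sB ?orbT.
- move=> v; rewrite inE => /orP[/Ap[x [u <-]]|/Bs[u <-]].
    by exists (Some x), u.
  by exists None, u.
case=> [x|] [x'|] u u' //= e; first by rewrite (pI _ _ _ _ e).
  by case: (dAB (phi x u)); [| rewrite e].
by case: (dAB (psi u)); [rewrite e |].
Qed.

Lemma tiled_factor : tiled is_edge m setT -> has_F_factor F H.
Proof.
move=> /tiled_copies[X [phi [pc _ Ap pI]]].
exists #|X|, (fun j => phi (enum_val j)); split=> [j|v|i j x y /pI /enum_val_inj //].
  exact: pc.
by have [x [u <-]] := Ap v (in_setT v); exists (enum_rank x), u; rewrite enum_rankK.
Qed.

End Copies.
End Translation.

Unset Implicit Arguments.

Theorem theorem1p4 (R : realType) (k m : nat) (eps : R)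
    (F : {set {set kvert k m}}) :
  (3 <= k)%N -> (1 <= m)%N -> 0 < eps -> kpartite_kgraph F ->
  exists n0 : nat, forall n : nat, (n0 <= n)%N -> (m %| n)%N ->
    forall H : {set {set kvert k n}}, kpartite_kgraph H ->
      (forall S : {set kvert k n}, legal S -> #|S| = k.-1 ->
         (2^-1 + eps) * n%:R <= (deg H S)%:R) ->
      has_F_factor F H.
Proof.
case: m F => [//|m] F k3 _ eps0 Fk.
have [n0 n0P] := complete_factor m k3 eps0.
exists n0 => n nn mn H Hk codeg; apply: tiled_factor => //.
apply: n0P; rewrite ?card_ord // => f i.
have [S [lS cS dS]] := deg_le Hk f i.
by apply: le_trans (codeg S lS cS) _; rewrite ler_nat.
Qed.
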